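(* Let $G$ be one of the Lie groups $G_{4,1,1}$, $G_{4,1,2}$, $G_{4,2,1(\lambda)}$, $G_{4,2,2}$, $G_{4,2,3(\varphi)}$ ($\varphi\neq\frac{\pi}{2}$), $G_{4,3,1(\lambda_1,\lambda_2)}$, $G_{4,3,2(\lambda)}$, $G_{4,3,3}$, $G_{4,3,4(\lambda,\varphi)}$ ($\varphi\neq\frac{\pi}{2}$), $G_{4,4,2}$, with Lie algebra $\mathfrak g$, and let $\Omega_F\subset\mathfrak g^*$ be a nontrivial co-adjoint orbit with an adapted chart $(\Omega_F,\psi^{-1})$. For $A\in\mathfrak g$ write $\widetilde A\circ\psi(p,q)=\Phi(q)p+\Psi(q)$. Then for each $A\in\mathfrak g$ and each compactly supported $C^\infty$-function $f\in C_c^\infty(\mathbb R^2)$ (a function of $(x,q)$), $$\hat\ell_A(f)=\Phi\left(q-\tfrac x2\right)\left(\tfrac12\partial_q-\partial_x\right)f+i\,\Psi\left(q-\tfrac x2\right)f,$$ and, in the new variables $s=q-\frac x2$, $t=q+\frac x2$, $$\hat\ell_A(f)=\Phi(s)\frac{\partial f}{\partial s}+i\Psi(s)f\Big|_{(s,t)},\qquad\text{i.e.}\qquad \hat\ell_A=\left[\Phi(s)\frac{\partial}{\partial s}+i\Psi(s)\right]\Big|_{(s,t)}.$$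
   Context: Each group $G_{\bullet}$ is the connected and simply connected Lie group with the 4-dimensional real Lie algebra $\mathfrak g_{\bullet}$ with basis $X,Y,Z,T$ and the following brackets (brackets of basis elements not determined by the listed ones and antisymmetry are zero): - $\mathfrak g_{4,1,1}$: $[T,X]=Z$. - $\mathfrak g_{4,1,2}$: $[T,Z]=Z$. - $\mathfrak g_{4,2,1(\lambda)}$, $\lambda\in\mathbb R\setminus\{0\}$: $[T,Y]=\lambda Y$, $[T,Z]=Z$. - $\mathfrak g_{4,2,2}$: $[T,Y]=Y$, $[T,Z]=Y+Z$. - $\mathfrak g_{4,2,3(\varphi)}$, $\varphi\in(0,\pi)$: $[T,Y]=\cos\varphi\,Y-\sin\varphi\,Z$, $[T,Z]=\sin\varphi\,Y+\cos\varphi\,Z$. - $\mathfrak g_{4,3,1(\lambda_1,\lambda_2)}$, $\lambda_1,\lambda_2\in\mathbb R\setminus\{0\}$: $[T,X]=\lambda_1X$, $[T,Y]=\lambda_2Y$, $[T,Z]=Z$. - $\mathfrak g_{4,3,2(\lambda)}$, $\lambda\in\mathbb R\setminus\{0\}$: $[T,X]=\lambda X$, $[T,Y]=X+\lambda Y$, $[T,Z]=Z$. - $\mathfrak g_{4,3,3}$: $[T,X]=X$, $[T,Y]=X+Y$, $[T,Z]=Y+Z$. - $\mathfrak g_{4,3,4(\lambda,\varphi)}$, $\lambda\in\mathbb R\setminus\{0\}$, $\varphi\in(0,\pi)$: $[T,X]=\cos\varphi\,X-\sin\varphi\,Y$, $[T,Y]=\sin\varphi\,X+\cos\varphi\,Y$,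 $[T,Z]=\lambda Z$. - $\mathfrak g_{4,4,2}$: $[T,X]=-X$, $[T,Y]=Y$, $[X,Y]=Z$. The co-adjoint action $K$ of $G$ on $\mathfrak g^*$ is $\langle K(g)F,X\rangle=\langle F,\mathrm{Ad}(g^{-1})X\rangle$; $\Omega_F$ is the orbit of $F$, nontrivial if it is not a single point. For $A\in\mathfrak g$, $\widetilde A(F')=\langle F',A\rangle$ on $\Omega_F$, and $\xi_A$ is the vector field $(\xi_Af)(x)=\frac{d}{dt}f(x\exp(tA))|_{t=0}$, where $x\exp(tA)=K(\exp(-tA))x$. The Kirillov form $\omega$ is determined by $\omega_{F'}(\xi_A,\xi_B)=\langle F',[A,B]\rangle$. An adapted chart is a pair $(\Omega_F,\psi^{-1})$ with $\psi:\mathbb R^2\to\Omega_F$ a global diffeomorphism such that (i) for every $A\in\mathfrak g$, $\widetilde A\circ\psi(p,q)=\Phi(q)p+\Psi(q)$ with $\Phi,\Psi\in C^\infty(\mathbb R)$ depending on $A$, and (ii) in the coordinates $(p,q)$, $\omega=dp\wedge dq$. Below $\widetilde A$ also stands for $\widetilde A\circ\psi$. Moyal product: for smooth $u,v$ on $\mathbb R^2$, $u\star v=uv+\sum_{r\ge1}\frac1{r!}\left(\frac1{2i}\right)^rP^r(u,v)$, where $P^r(u,v)=\Lambda^{i_1j_1}\cdots\Lambda^{i_rj_r}\,\partial^r_{i_1\dots i_r}u\;\partial^r_{j_1\dots j_r}v$ (summation over repeated indices in $\{p,q\}$), with $\Lambda^{pq}=1=-\Lambda^{qp}$, $\Lambda^{pp}=\Lambda^{qq}=0$;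 so $P^1(u,v)=\partial_pu\,\partial_qv-\partial_qu\,\partial_pv$. $\ell_A(f)=i\widetilde A\star f$. The partial Fourier transform from the variable $p$ to the variable $x$ is $\mathcal F_p(f)(x,q)=\frac1{\sqrt{2\pi}}\int_{\mathbb R}e^{-ipx}f(p,q)\,dp$, with inverse $\mathcal F_p^{-1}$. The operator $\hat\ell_A$ is $\hat\ell_A=\mathcal F_p\circ\ell_A\circ\mathcal F_p^{-1}$ (with $\mathcal F_p$ applied termwise to the series defining $\star$).
   Formalization: Both printed formulas lack a term: ½Φ'(q−x/2)f, i.e. ½Φ'(s)f, is added on the right; they are asserted when the series defining the operator converges at every point for every f in C_c^∞, which is shown to hold when Φ and Ψ are everywhere the sums of their Taylor series. *)

(* Defs.v *)
(* Stdlib reals + Coquelicot. *)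
From Stdlib Require Import Reals Factorial.
From Coquelicot Require Import Coquelicot.
Open Scope R_scope.

(* Both the Lie algebra g and its dual g^* are R^4: coordinates in the basis
   X, Y, Z, T, respectively in the dual basis. *)
Notation R4 := (R * R * R * R)%type.

Definition cX (v : R4) : R := fst (fst (fst v)).
Definition cY (v : R4) : R := snd (fst (fst v)).
Definition cZ (v : R4) : R := snd (fst v).
Definition cT (v : R4) : R := snd v.

Definition eX : R4 := (1, 0, 0, 0).
Definition eY : R4 := (0, 1, 0, 0).
Definition eZ : R4 := (0, 0, 1, 0).
Definition eT : R4 := (0, 0, 0, 1).

Definition pairing (F A : R4) : R :=
  cX F * cX A + cY F * cY A + cZ F * cZ A + cT F * cT A.

Inductive MD4 : Type :=
| G411
| G412
| G421 (lambda : R)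
| G422
| G423 (phi : R)
| G431 (lambda1 lambda2 : R)
| G432 (lambda : R)
| G433
| G434 (lambda phi : R)
| G442.

Definition admissible (G : MD4) : Prop :=
  match G with
  | G421 l | G432 l => l <> 0
  | G423 phi => 0 < phi < PI /\ phi <> PI / 2
  | G431 l1 l2 => l1 <> 0 /\ l2 <> 0
  | G434 l phi => l <> 0 /\ 0 < phi < PI /\ phi <> PI / 2
  | G411 | G412 | G422 | G433 | G442 => True
  end.

Definition TX (G : MD4) : R4 :=
  match G with
  | G411 => eZ
  | G431 l1 _ => (l1, 0, 0, 0)
  | G432 l => (l, 0, 0, 0)
  | G433 => eX
  | G434 _ phi => (cos phi, - sin phi, 0, 0)
  | G442 => (-1, 0, 0, 0)
  | _ => (0, 0, 0, 0)
  end.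

Definition TY (G : MD4) : R4 :=
  match G with
  | G421 l => (0, l, 0, 0)
  | G422 => eY
  | G423 phi => (0, cos phi, - sin phi, 0)
  | G431 _ l2 => (0, l2, 0, 0)
  | G432 l => (1, l, 0, 0)
  | G433 => (1, 1, 0, 0)
  | G434 _ phi => (sin phi, cos phi, 0, 0)
  | G442 => eY
  | _ => (0, 0, 0, 0)
  end.

Definition TZ (G : MD4) : R4 :=
  match G with
  | G412 | G421 _ | G431 _ _ | G432 _ => eZ
  | G422 | G433 => (0, 1, 1, 0)
  | G423 phi => (0, sin phi, cos phi, 0)
  | G434 l _ => (0, 0, l, 0)
  | _ => (0, 0, 0, 0)
  end.

Definition XY (G : MD4) : R4 :=
  match G with G442 => eZ | _ => (0, 0, 0, 0) end.

(* In all these algebras [X,Z] = [Y,Z] = 0; TX, TY, TZ, XY are [T,X], [T,Y],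
   [T,Z], [X,Y], and the bracket is their bilinear antisymmetric extension. *)
Definition bracket (G : MD4) (A B : R4) : R4 :=
  plus (plus (scal (cT A * cX B - cX A * cT B) (TX G))
             (scal (cT A * cY B - cY A * cT B) (TY G)))
       (plus (scal (cT A * cZ B - cZ A * cT B) (TZ G))
             (scal (cX A * cY B - cY A * cX B) (XY G))).

(* Ad (exp A) = e^{ad A}. *)
Definition Ad_exp (G : MD4) (A B : R4) : R4 :=
  let coord (c : R4 -> R) :=
    Series (fun k => c (Nat.iter k (bracket G A) B) / INR (fact k)) in
  (coord cX, coord cY, coord cZ, coord cT).

(* K (exp A) F, i.e. <K (exp A) F, B> = <F, Ad (exp (- A)) B>. *)
Definition K_exp (G : MD4) (A F : R4) : R4 :=
  let coord (e : R4) := pairing F (Ad_exp G (opp A) e) in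
  (coord eX, coord eY, coord eZ, coord eT).

(* The group is connected, so each of its elements is a finite product of
   exponentials: this is the orbit of F under the whole group. *)
Inductive orbit (G : MD4) (F : R4) : R4 -> Prop :=
| orbit_base : orbit G F F
| orbit_step (A F' : R4) : orbit G F F' -> orbit G F (K_exp G A F').

Definition nontrivial_orbit (G : MD4) (F : R4) : Prop :=
  exists F' : R4, orbit G F F' /\ F' <> F.

(* C^n for maps between finite-dimensional real spaces: all iterated
   directional derivatives up to order n exist, and those of order n are
   continuous. *)
Fixpoint Cn {V W : NormedModule R_AbsRing} (n : nat) (f : V -> W) : Prop :=
  match n with
  | O => forall m : V, continuous f m
  | S n' => forall v : V, exists g : V -> W,
      (forall m : V,
         is_derive (fun t : R => f (plus m (scal t v))) 0 (g m))
      /\ Cn n' g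
  end.

Definition smooth {V W : NormedModule R_AbsRing} (f : V -> W) : Prop :=
  forall n : nat, Cn n f.

(* The orbits carry the structure of submanifolds of g^*; smoothness of the
   inverse on the orbit means that it extends, near each point of the orbit, to
   a smooth map of the ambient space (a cut-off makes the extension global). *)
Definition diffeo_onto_orbit (G : MD4) (F : R4) (psi : R * R -> R4) : Prop :=
  smooth psi
  /\ (forall m m' : R * R, psi m = psi m' -> m = m')
  /\ (forall F' : R4, orbit G F F' <-> exists m : R * R, psi m = F')
  /\ (forall m : R * R, exists (U : R4 -> Prop) (chi : R4 -> R * R),
        locally (psi m) U /\ smooth chi
        /\ forall m' : R * R, U (psi m') -> chi (psi m') = m').

(* a = (a_p, a_q) are the coordinates, in the chart and at the point psi m, of
   the tangent vector xi_A, the velocity at t = 0 of t |-> K (exp (- t A)). *)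
Definition xi_coord (G : MD4) (psi : R * R -> R4) (A : R4) (m a : R * R) : Prop :=
  exists v : R4,
    is_derive (fun t : R => psi (plus m (scal t a))) 0 v
    /\ is_derive (fun t : R => K_exp G (opp (scal t A)) (psi m)) 0 v.

Definition adapted_chart (G : MD4) (F : R4) (psi : R * R -> R4) : Prop :=
  diffeo_onto_orbit G F psi
  /\ (forall A : R4, exists Phi Psi : R -> R,
        smooth Phi /\ smooth Psi
        /\ forall p q : R, pairing (psi (p, q)) A = Phi q * p + Psi q)
  /\ (* omega = dp /\ dq *)
     (forall (A B : R4) (m a b : R * R),
        xi_coord G psi A m a -> xi_coord G psi B m b ->
        fst a * snd b - snd a * fst b = pairing (psi m) (bracket G A B)).

(* The function A~ o psi, seen as complex valued. *)
Definition tilde (psi : R * R -> R4) (A : R4) (m : R * R) : C :=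
  RtoC (pairing (psi m) A).

Definition CDerive (h : R -> C) (t : R) : C :=
  (Derive (fun u => Re (h u)) t, Derive (fun u => Im (h u)) t).

Definition D1 (u : R * R -> C) (m : R * R) : C :=
  CDerive (fun a => u (a, snd m)) (fst m).
Definition D2 (u : R * R -> C) (m : R * R) : C :=
  CDerive (fun b => u (fst m, b)) (snd m).

Inductive index : Type := ip | iq.

Definition partial (i : index) : (R * R -> C) -> R * R -> C :=
  match i with ip => D1 | iq => D2 end.

Definition Lambda (i j : index) : C :=
  match i, j with
  | ip, iq => RtoC 1
  | iq, ip => RtoC (-1)
  | _, _ => RtoC 0
  end.

Definition sum_index (g : index -> C) : C := (g ip + g iq)%C.

(* P^r(u,v), one pair of indices (i_k, j_k) being summed at each step. *)
Fixpoint P (r : nat) (u v : R * R -> C) (m : R * R) : C :=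
  match r with
  | O => (u m * v m)%C
  | S r' => sum_index (fun i => sum_index (fun j =>
              (Lambda i j * P r' (partial i u) (partial j v) m)%C))
  end.

(* The r-th term of the Moyal product u * v; for r = 0 it is u v. *)
Definition star_term (r : nat) (u v : R * R -> C) (m : R * R) : C :=
  (RtoC (/ INR (fact r)) * Cpow (/ (2 * Ci)) r * P r u v m)%C.

Definition Cis (t : R) : C := (cos t, sin t).

Definition CInt (h : R -> C) : C :=
  RInt_gen (V := C_R_CompleteNormedModule) h
    (Rbar_locally m_infty) (Rbar_locally p_infty).

Definition Fourier_p (f : R * R -> C) (m : R * R) : C :=
  (RtoC (/ sqrt (2 * PI)) *
   CInt (fun p => Cis (- (p * fst m)) * f (p, snd m)))%C.

Definition Fourier_p_inv (f : R * R -> C) (m : R * R) : C :=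
  (RtoC (/ sqrt (2 * PI)) *
   CInt (fun x => Cis (fst m * x) * f (x, snd m)))%C.

(* Here u stands for A~ o psi: the r-th term of F_p (i u * F_p^{-1} f). *)
Definition ell_hat_term (u f : R * R -> C) (m : R * R) (r : nat) : C :=
  Fourier_p (fun m' => Ci * star_term r u (Fourier_p_inv f) m')%C m.

Definition CSeries (a : nat -> C) : C :=
  (Series (fun r => Re (a r)), Series (fun r => Im (a r))).

Definition ell_hat (u f : R * R -> C) (m : R * R) : C :=
  CSeries (ell_hat_term u f m).

Definition Cc_smooth (f : R * R -> C) : Prop :=
  smooth (V := prod_NormedModule R_AbsRing R_NormedModule R_NormedModule)
         (W := C_R_NormedModule) f
  /\ exists M : R, forall x q : R,
       M < Rabs x \/ M < Rabs q -> f (x, q) = RtoC 0.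

(* The operator is defined on all of C_c^oo, i.e. its series converges. *)
Definition ell_hat_defined (u : R * R -> C) : Prop :=
  forall f : R * R -> C, Cc_smooth f ->
  forall m : R * R,
    ex_series (K := R_AbsRing) (V := C_R_NormedModule) (ell_hat_term u f m).

(* h is everywhere the sum of its Taylor series. *)
Definition entire (h : R -> R) : Prop :=
  forall a y : R,
    is_series (fun k : nat => Derive_n h k a / INR (fact k) * (y - a) ^ k) (h y).

(* (s, t) |-> (x, q), the inverse of s = q - x/2, t = q + x/2. *)
Definition xq_of_st (m : R * R) : R * R :=
  (snd m - fst m, (fst m + snd m) / 2).

(* Main.v *)
Require Import Defs.
From Stdlib Require Import Reals Factorial Arith Lra Lia Psatz.
From Stdlib Require Import Classical ClassicalEpsilon FunctionalExtensionality.
From Coquelicot Require Import Coquelicot.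
Open Scope R_scope.
Set Bullet Behavior "Strict Subproofs".

(** The function [Phi q * p + Psi q] has degree one in [p], so in the
    bidifferential operator [P r] at most one derivative in [p] falls on it:
    up to signs,

      [P r u v = (Phi^(r) p + Psi^(r)) d_p^r v  +  r Phi^(r-1) d_q d_p^(r-1) v].

    For [v = F_p^(-1) f] the derivative [d_p] is multiplication of [f] by
    [i x], the derivative [d_q] falls on [f], and multiplication by [p] is
    [i d_x].  Applying [F_p] and Fourier inversion, the [r]-th term of the
    series becomes explicit ([ell_hat_term_symbol]): with [y = - x / 2],

      [y^r/r! (- Phi^(r) d_x f + i Psi^(r) f)
       + y^(r-1)/(r-1)! (Phi^(r) f + Phi^(r-1) d_q f) / 2].

    These are Taylor terms, centred at [q], of [Phi], [Psi] and [Phi'] at the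
    point [q + y = q - x / 2]; the summand [Phi' f / 2] comes from [d_x] falling
    on the power [(i x)^r].  The formula in [(s, t)] is then the chain rule
    ([D1_comp_xq_of_st]).

    Two facts of analysis carry the argument.

    The first is Fourier inversion for smooth compactly supported functions and
    improper Riemann integrals.  Splitting [h z = h 0 + z k z], with [k] of
    class C^1, the integral in [p] has the explicit primitive
    [2 h(0) Si(L p) + int k(z) sin(p z) dz]: the second part vanishes at
    infinity by one integration by parts ([riemann_lebesgue]) and the first is
    the Dirichlet integral ([filterlim_Si]).

    The second is Pringsheim's theorem ([pringsheim]).  When the operator is
    defined, testing it on bump functions shows that the Taylor series of [Psi]
    and [Phi'] at every centre converge everywhere, but a convergent Taylor
    series of a smooth function need not have that function as its sum.  Because
    the convergence holds at all centres, a Baire category argument shows that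
    it does.  The same theorem, applied to entire [Phi] and [Psi], yields the
    expansion of [Phi'] needed for the operator to be defined. *)

(** Equalities produced by lemmas on normed modules live on the carrier of a
    structure, where [ring], [field] and [lra] do not recognize the field. *)
Ltac in_R := match goal with |- ?a = ?b => change (@eq R a b) end.
Ltac in_C := match goal with |- ?a = ?b => change (@eq C a b) end.

(** * Pringsheim's theorem *)

(** That is, a binomial coefficient is at most the corresponding power of 2: it
    doubles the growth rate whenever the centre of an expansion moves. *)
Lemma fact_add_le (r m : nat) : (fact (r + m) <= fact r * fact m * 2 ^ (r + m))%nat.
Proof.
  remember (r + m)%nat as s eqn:E. revert r m E.
  induction s as [|s IH]; intros r m E.
  - assert (r = 0)%nat by lia; assert (m = 0)%nat by lia; subst; simpl; lia.
  - destruct r as [|r]; [|destruct m as [|m]].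
    + simpl in E; subst m. assert (1 <= 2 ^ S s)%nat by (apply Nat.neq_0_lt_0; apply Nat.pow_nonzero; lia).
      change (fact 0) with 1%nat. nia.
    + assert (S r = S s) by lia. rewrite H.
      assert (1 <= 2 ^ S s)%nat by (apply Nat.neq_0_lt_0; apply Nat.pow_nonzero; lia).
      change (fact 0) with 1%nat. nia.
    + assert (H1 := IH r (S m) ltac:(lia)). assert (H2 := IH (S r) m ltac:(lia)).
      change (fact (S s)) with (S s * fact s)%nat.
      replace (S s) with (S r + S m)%nat by lia.
      replace (2 ^ (S r + S m))%nat with (2 * 2 ^ s)%nat
        by (replace (S r + S m)%nat with (S s) by lia; reflexivity).
      change (fact (S r)) with (S r * fact r)%nat in *.
      change (fact (S m)) with (S m * fact m)%nat in *.
      assert (H3 := Nat.mul_le_mono_l _ _ (S r) H1).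
      assert (H4 := Nat.mul_le_mono_l _ _ (S m) H2).
      lia.
Qed.

Lemma INR_fact_add_le (r m : nat) :
  INR (fact (r + m)) <= INR (fact r) * INR (fact m) * 2 ^ (r + m).
Proof.
  rewrite <- !mult_INR. replace 2 with (INR 2) by (simpl; lra).
  rewrite <- pow_INR, <- mult_INR. apply le_INR, fact_add_le.
Qed.

Definition infinitely_derivable (g : R -> R) := forall n x, ex_derive_n g n x.

Lemma is_derive_Derive_n (g : R -> R) (n : nat) (x : R) :
  infinitely_derivable g -> is_derive (Derive_n g n) x (Derive_n g (S n) x).
Proof. intros H. apply Derive_correct. exact (H (S n) x). Qed.

Lemma continuous_Derive_n (g : R -> R) (n : nat) (x : R) :
  infinitely_derivable g -> continuous (Derive_n g n) x.
Proof.
  intros H. apply @ex_derive_continuous.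
  eexists; apply (is_derive_Derive_n g n x H).
Qed.

(** All derivatives are required at once, so that no theorem on termwise
    differentiation of power series is used. *)
Definition expands (g : R -> R) (c z : R) :=
  forall r : nat,
    is_series (fun k : nat => Derive_n g (r + k) c / INR (fact k) * (z - c) ^ k)
      (Derive_n g r z).

(** Cauchy's estimates at the single point [x], for a disc of radius [/ B]. *)
Definition growth (g : R -> R) (K B x : R) :=
  forall k : nat, Rabs (Derive_n g k x) <= K * INR (fact k) * B ^ k.

Lemma segment_derive_n (g : R -> R) (c z : R) (r k : nat) (s : R) :
  infinitely_derivable g ->
  is_derive_n (fun u => Derive_n g r (c + u * (z - c))) k s
    ((z - c) ^ k * Derive_n g (r + k) (c + s * (z - c))).
Proof.
  intros H. revert s. induction k as [|k IH]; intros s.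
  - simpl. rewrite Nat.add_0_r. ring.
  - simpl. apply is_derive_ext with
      (f := fun s => (z - c) ^ k * Derive_n g (r + k) (c + s * (z - c))).
    { intros t. symmetry. apply is_derive_n_unique, IH. }
    replace (r + S k)%nat with (S (r + k)) by lia.
    evar_last.
    { apply is_derive_scal.
      apply (is_derive_comp (Derive_n g (r + k)) (fun s => c + s * (z - c))).
      - apply is_derive_Derive_n, H.
      - auto_derive; [exact I | reflexivity]. }
    unfold scal; simpl; unfold mult; simpl. ring.
Qed.

Lemma pow_lim_0 (C q : R) : 0 <= q < 1 -> is_lim_seq (fun n => C * q ^ n) 0.
Proof.
  intros H. replace (Finite 0) with (Rbar_mult C 0) by (simpl; f_equal; ring).
  apply is_lim_seq_scal_l. apply is_lim_seq_geom. rewrite Rabs_pos_eq; lra.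
Qed.

(** Taylor's formula with Lagrange remainder along the segment from [c] to [z];
    parametrizing the segment by [0, 1] treats both orientations at once. *)
Lemma growth_expands (g : R -> R) (K B c z : R) :
  infinitely_derivable g -> 0 <= K -> 0 <= B -> 4 * B * Rabs (z - c) <= 1 ->
  (forall s, 0 <= s <= 1 -> growth g K B (c + s * (z - c))) ->
  expands g c z.
Proof.
  intros Hg HK HB Hsmall Hb r.
  set (a := fun k : nat => Derive_n g (r + k) c / INR (fact k) * (z - c) ^ k).
  set (C := K * INR (fact r) * (2 * B) ^ r).
  assert (HC : 0 <= C).
  { unfold C. repeat apply Rmult_le_pos; try lra. apply pos_INR. apply pow_le; lra. }
  assert (Herr : forall n, Rabs (sum_f_R0 a n - Derive_n g r z) <= C * (/ 2) ^ n).
  { intros n.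
    destruct (Taylor_Lagrange (fun u => Derive_n g r (c + u * (z - c))) n 0 1 Rlt_0_1)
      as [s [Hs Heq]].
    { intros t _ k _. destruct k as [|k]; [exact I|].
      eexists. apply (segment_derive_n g c z r (S k) t Hg). }
    replace (c + 1 * (z - c)) with z in Heq by ring.
    rewrite (is_derive_n_unique _ _ _ _ (segment_derive_n g c z r (S n) s Hg)) in Heq.
    replace (sum_f_R0 (fun m : nat =>
           (1 - 0) ^ m / INR (fact m) *
           Derive_n (fun u : R => Derive_n g r (c + u * (z - c))) m 0) n)
      with (sum_f_R0 a n) in Heq.
    2:{ apply sum_eq. intros i _.
        rewrite (is_derive_n_unique _ _ _ _ (segment_derive_n g c z r i 0 Hg)).
        unfold a. rewrite Rminus_0_r, pow1, Rmult_0_l, Rplus_0_r. field. apply INR_fact_neq_0. }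
    rewrite Heq, Rminus_0_r, pow1.
    set (m := S n) in *.
    match goal with |- Rabs ?e <= _ => replace e with
      (- ((z - c) ^ m * Derive_n g (r + m) (c + s * (z - c)) / INR (fact m)))
      by (unfold Rdiv; ring) end.
    rewrite Rabs_Ropp. unfold Rdiv. rewrite !Rabs_mult, <- RPow_abs, (Rabs_pos_eq (/ _)).
    2:{ apply Rlt_le, Rinv_0_lt_compat, INR_fact_lt_0. }
    assert (Hd : 0 <= Rabs (z - c)) by apply Rabs_pos.
    set (d := Rabs (z - c)) in *.
    assert (Hgr := Hb s ltac:(lra) (r + m)%nat).
    assert (Hf := INR_fact_add_le r m).
    apply Rle_trans with (d ^ m * (K * (INR (fact r) * INR (fact m) * 2 ^ (r + m)) * B ^ (r + m))
        * / INR (fact m)).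
    { apply Rmult_le_compat_r. apply Rlt_le, Rinv_0_lt_compat, INR_fact_lt_0.
      apply Rmult_le_compat_l. apply pow_le; lra.
      eapply Rle_trans; [exact Hgr|].
      apply Rmult_le_compat_r. apply pow_le; lra.
      apply Rmult_le_compat_l; lra. }
    replace (d ^ m * (K * (INR (fact r) * INR (fact m) * 2 ^ (r + m)) * B ^ (r + m)) * / INR (fact m))
      with (C * (2 * B * d) ^ m).
    2:{ unfold C. rewrite !pow_add, !Rpow_mult_distr. field. apply INR_fact_neq_0. }
    apply Rmult_le_compat_l; [exact HC|].
    assert (0 <= 2 * B * d) by (apply Rmult_le_pos; lra).
    apply Rle_trans with ((/2) ^ m).
    { apply pow_incr. lra. }
    unfold m. simpl. assert (0 <= (/2) ^ n) by (apply pow_le; lra). lra. }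
  change (is_lim_seq (sum_n a) (Derive_n g r z)).
  apply is_lim_seq_ext with (fun n => Derive_n g r z + (sum_f_R0 a n - Derive_n g r z)).
  { intros n. rewrite sum_n_Reals. ring. }
  replace (Finite (Derive_n g r z)) with (Finite (Derive_n g r z + 0)) by (f_equal; ring).
  apply (is_lim_seq_plus' _ _ _ _ (is_lim_seq_const _)).
  apply is_lim_seq_abs_0.
  apply is_lim_seq_le_le with (u := fun _ => 0) (w := fun n => C * (/2) ^ n).
  - intros n; split; [apply Rabs_pos | apply Herr].
  - apply is_lim_seq_const.
  - apply pow_lim_0. lra.
Qed.

Lemma series_geom_bound (a : nat -> R) (l C : R) :
  is_series a l -> (forall n, Rabs (a n) <= C * (/ 2) ^ n) -> Rabs l <= 2 * C.
Proof.
  intros Hl Ha. rewrite <- (is_series_unique _ _ Hl).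
  assert (Hgeo : is_series (fun n => C * (/2) ^ n) (2 * C)).
  { replace (2 * C) with (C * / (1 - / 2)) by field.
    apply (is_series_scal (V := R_NormedModule) C (fun n => (/2) ^ n)).
    apply is_series_geom. rewrite Rabs_pos_eq; lra. }
  assert (Hex : ex_series (fun n => Rabs (a n))).
  { apply (@ex_series_le R_AbsRing R_CompleteNormedModule) with (fun n => C * (/2) ^ n).
    - intros n. unfold norm; simpl; unfold abs; simpl. rewrite Rabs_Rabsolu. apply Ha.
    - eexists; exact Hgeo. }
  eapply Rle_trans. { apply Series_Rabs, Hex. }
  rewrite <- (is_series_unique _ _ Hgeo).
  apply Series_le. { intros n; split; [apply Rabs_pos | apply Ha]. }
  eexists; exact Hgeo.
Qed.

(** An estimate at the centre propagates along an expansion, at the price of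
    doubling both constants: the series of derivatives is dominated by a
    geometric one. *)
Lemma expands_growth (g : R -> R) (K B c z : R) :
  0 <= K -> 0 <= B -> 4 * B * Rabs (z - c) <= 1 ->
  growth g K B c -> expands g c z -> growth g (2 * K) (2 * B) z.
Proof.
  intros HK HB Hsmall Hc He r.
  replace (2 * K * INR (fact r) * (2 * B) ^ r) with (2 * (K * INR (fact r) * (2 * B) ^ r)) by ring.
  apply series_geom_bound with (1 := He r). intros k.
  unfold Rdiv. rewrite !Rabs_mult, <- RPow_abs, (Rabs_pos_eq (/ _)).
  2:{ apply Rlt_le, Rinv_0_lt_compat, INR_fact_lt_0. }
  assert (Hd : 0 <= Rabs (z - c)) by apply Rabs_pos. set (d := Rabs (z - c)) in *.
  assert (Hf := INR_fact_add_le r k).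
  apply Rle_trans with (K * (INR (fact r) * INR (fact k) * 2 ^ (r + k)) * B ^ (r + k) * / INR (fact k) * d ^ k).
  { apply Rmult_le_compat_r. apply pow_le; lra.
    apply Rmult_le_compat_r. apply Rlt_le, Rinv_0_lt_compat, INR_fact_lt_0.
    eapply Rle_trans; [apply Hc|]. apply Rmult_le_compat_r. apply pow_le; lra.
    apply Rmult_le_compat_l; lra. }
  replace (K * (INR (fact r) * INR (fact k) * 2 ^ (r + k)) * B ^ (r + k) * / INR (fact k) * d ^ k)
    with (K * INR (fact r) * (2 * B) ^ r * (2 * B * d) ^ k).
  2:{ rewrite !pow_add, !Rpow_mult_distr. field. apply INR_fact_neq_0. }
  apply Rmult_le_compat_l.
  { repeat apply Rmult_le_pos; try lra. apply pos_INR. apply pow_le; lra. }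
  apply pow_incr. split; [|lra]. apply Rmult_le_pos; lra.
Qed.

Lemma growth_weaken (g : R -> R) (K K' B B' x : R) :
  0 <= K <= K' -> 0 <= B <= B' -> growth g K B x -> growth g K' B' x.
Proof.
  intros HK HB H k. eapply Rle_trans; [apply H|].
  apply Rmult_le_compat.
  - apply Rmult_le_pos; [lra | apply pos_INR].
  - apply pow_le; lra.
  - apply Rmult_le_compat_r; [apply pos_INR | lra].
  - apply pow_incr; lra.
Qed.

Lemma growth_closed (g : R -> R) (K B x : R) :
  infinitely_derivable g ->
  (forall eps : posreal, exists y, Rabs (y - x) < eps /\ growth g K B y) -> growth g K B x.
Proof.
  intros Hg Hy k. apply Rnot_lt_le. intros Hlt.
  assert (Hc : continuous (fun u => Rabs (Derive_n g k u)) x).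
  { apply continuous_comp; [apply continuous_Derive_n, Hg | apply continuous_Rabs]. }
  destruct (Hc (fun v => K * INR (fact k) * B ^ k < v)) as [eps He].
  { apply open_gt. exact Hlt. }
  destruct (Hy eps) as [y [Hd Hgr]].
  specialize (He y Hd). specialize (Hgr k). lra.
Qed.

Definition expands_on (g : R -> R) (a b : R) :=
  forall c z, a <= c <= b -> a <= z <= b -> expands g c z.

(** The points of a segment satisfying a growth estimate form a closed set, so
    there is a last one on the way from [x] to [y]. *)
Lemma last_growth_point (g : R -> R) (K B x y : R) :
  infinitely_derivable g -> growth g K B x ->
  exists u, 0 <= u <= 1 /\ growth g K B (x + u * (y - x))
    /\ forall v, u < v <= 1 -> ~ growth g K B (x + v * (y - x)).
Proof.
  intros Hg Hx.
  set (E := fun u => 0 <= u <= 1 /\ growth g K B (x + u * (y - x))).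
  assert (E0 : E 0).
  { split; [lra|]. replace (x + 0 * (y - x)) with x by ring. exact Hx. }
  destruct (completeness E) as [u [Hub Hlub]].
  - exists 1. intros v [Hv _]. lra.
  - exists 0. exact E0.
  - exists u. assert (0 <= u) by (apply Hub, E0).
    assert (u <= 1) by (apply Hlub; intros v [Hv _]; lra).
    split; [lra|]. split.
    + apply growth_closed; [exact Hg|]. intros eps.
      assert (Hd : 0 < eps / (Rabs (y - x) + 1)).
      { apply Rdiv_lt_0_compat; [apply cond_pos|]. pose proof (Rabs_pos (y - x)). lra. }
      destruct (classic (exists v, E v /\ u - eps / (Rabs (y - x) + 1) < v)) as [[v [Hv Hlt]]|Hno].
      * exists (x + v * (y - x)). split; [|apply Hv].
        replace (x + v * (y - x) - (x + u * (y - x))) with ((v - u) * (y - x)) by ring.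
        rewrite Rabs_mult.
        assert (v <= u) by (apply Hub, Hv).
        rewrite (Rabs_left1 (v - u)) by lra.
        assert (Hp := Rabs_pos (y - x)).
        apply Rle_lt_trans with (- (v - u) * (Rabs (y - x) + 1)).
        { apply Rmult_le_compat_l; lra. }
        apply Rlt_le_trans with (eps / (Rabs (y - x) + 1) * (Rabs (y - x) + 1)).
        { apply Rmult_lt_compat_r; lra. }
        right. field. lra.
      * exfalso. assert (u <= u - eps / (Rabs (y - x) + 1)); [|lra].
        apply Hlub. intros v Hv. apply Rnot_lt_le. intros Hlt. apply Hno. exists v. split; assumption.
    + intros v Hv Hgr. assert (v <= u); [|lra]. apply Hub. split; [lra | exact Hgr].
Qed.

(** The local step of Pringsheim's theorem.  Call an interval bad if
    [expands_on] fails on it, and suppose that every bad subinterval contains a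
    point where the uniform estimate holds.  From an arbitrary [y], walk towards
    such a point [x] and stop at the first point [w] satisfying the uniform
    estimate.  Between [w] and [y] there is no bad interval, so [g] is given
    there by its expansion at [y], hence also by the one at [w], and the uniform
    estimate at [w] passes to [y].  Holding at every [y], it gives the
    expansions on the whole interval. *)
Lemma expands_on_of_dense_growth (g : R -> R) (K B a b : R) :
  infinitely_derivable g ->
  0 <= K -> 0 <= B -> 8 * B * (b - a) <= 1 ->
  (forall x, a <= x <= b -> exists K', growth g K' B x) ->
  (forall a' b', a <= a' -> a' <= b' -> b' <= b -> ~ expands_on g a' b' ->
     exists x, a' <= x <= b' /\ growth g K B x) ->
  expands_on g a b.
Proof.
  intros Hg HK HB HBs Hpt Hdense.
  destruct (classic (expands_on g a b)) as [|Hbad]; [assumption|].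
  destruct (Rle_dec a b) as [Hab|Hab]; [|intros c z; lra].
  destruct (Hdense a b ltac:(lra) Hab ltac:(lra) Hbad) as [x [Hx Hgx]].
  assert (Hconv : forall p q s, a <= p <= b -> a <= q <= b -> 0 <= s <= 1 ->
    a <= p + s * (q - p) <= b) by (intros; split; nra).
  assert (Hdist : forall p q, a <= p <= b -> a <= q <= b -> 4 * (2 * B) * Rabs (p - q) <= 1).
  { intros p q Hp Hq. apply Rle_trans with (8 * B * (b - a)); [|lra].
    replace (4 * (2 * B)) with (8 * B) by ring.
    apply Rmult_le_compat_l; [lra|]. apply Rabs_le; lra. }
  assert (Hdist1 : forall p q, a <= p <= b -> a <= q <= b -> 4 * B * Rabs (p - q) <= 1).
  { intros p q Hp Hq. specialize (Hdist p q Hp Hq). pose proof (Rabs_pos (p - q)). nra. }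
  assert (Hunif : forall y, a <= y <= b -> growth g (2 * K) (2 * B) y).
  { intros y Hy.
    destruct (last_growth_point g K B x y Hg Hgx) as [u [Hu [Hgu Hlast]]].
    set (w := fun v => x + v * (y - x)).
    assert (Hw : forall v, 0 <= v <= 1 -> a <= w v <= b) by (intros; apply Hconv; lra).
    assert (Hw1 : w 1 = y) by (unfold w; ring).
    destruct (Req_dec u 1) as [->|Hu1].
    { rewrite <- Hw1. apply growth_weaken with K B; [lra | lra | exact Hgu]. }
    (* [Ky] depends on [y] and only serves to reach [w u]; it disappears from the
       final estimate. *)
    destruct (Hpt y Hy) as [Ky HKy].
    assert (HKy0 : 0 <= Ky).
    { specialize (HKy 0%nat). simpl in HKy. pose proof (Rabs_pos (g y)). lra. }
    assert (Hexp : forall v, u < v <= 1 -> expands g y (w v)).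
    { intros v Hv.
      assert (Hg' : expands_on g (Rmin (w v) y) (Rmax (w v) y)).
      { assert (Hwv := Hw v ltac:(lra)).
        apply NNPP. intros Hn.
        destruct (Hdense (Rmin (w v) y) (Rmax (w v) y)) as [x' [Hx' Hgx']]; try assumption.
        - apply Rmin_glb; lra.
        - apply Rle_trans with y; [apply Rmin_r | apply Rmax_r].
        - apply Rmax_lub; lra.
        - assert (Hex : exists v', v <= v' <= 1 /\ w v' = x').
          { destruct (Req_dec (w v) y) as [E|E].
            - exists 1. split; [lra|]. rewrite E in Hx'.
              rewrite Rmin_left, Rmax_left in Hx' by lra. lra.
            - assert (Hne : y - w v <> 0) by lra.
              assert (Ht : 0 <= (x' - w v) / (y - w v) <= 1).
              { destruct (Rle_dec (w v) y) as [Hle|Hle].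
                - rewrite Rmin_left, Rmax_right in Hx' by lra. split.
                  + apply Rdiv_le_0_compat; lra.
                  + apply Rle_div_l; lra.
                - rewrite Rmin_right, Rmax_left in Hx' by lra.
                  replace ((x' - w v) / (y - w v)) with ((w v - x') / (w v - y)) by (field; lra).
                  split.
                  + apply Rdiv_le_0_compat; lra.
                  + apply Rle_div_l; lra. }
              set (t := (x' - w v) / (y - w v)) in *.
              exists (v + t * (1 - v)). split; [nra|].
              replace (w (v + t * (1 - v))) with (w v + t * (y - w v)) by (unfold w; ring).
              unfold t. field. lra. }
          destruct Hex as [v' [Hv' <-]].
          apply (Hlast v'); [lra | exact Hgx']. }
      apply Hg'; split; auto using Rmin_l, Rmin_r, Rmax_l, Rmax_r. }
    assert (Hbd : forall v, u <= v <= 1 -> growth g (2 * Ky) (2 * B) (w v)).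
    { intros v Hv. destruct (Req_dec v u) as [->|Hvu].
      - apply growth_closed; [exact Hg|]. intros eps.
        set (t := Rmin (1 - u) (eps / (2 * (Rabs (y - x) + 1)))).
        assert (Hp := Rabs_pos (y - x)).
        assert (Ht : 0 < t).
        { apply Rmin_pos; [lra|]. apply Rdiv_lt_0_compat; [apply cond_pos | lra]. }
        assert (Ht1 : t <= 1 - u) by apply Rmin_l.
        exists (w (u + t)). split.
        + replace (w (u + t) - w u) with (t * (y - x)) by (unfold w; ring).
          rewrite Rabs_mult, Rabs_pos_eq by lra.
          apply Rle_lt_trans with (eps / (2 * (Rabs (y - x) + 1)) * (Rabs (y - x) + 1)).
          { apply Rmult_le_compat; try lra. apply Rmin_r. }
          replace (eps / (2 * (Rabs (y - x) + 1)) * (Rabs (y - x) + 1)) with (eps / 2) by (field; lra).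
          pose proof (cond_pos eps). lra.
        + apply expands_growth with y; auto; [|apply Hexp; lra].
          apply Hdist1; [apply Hw; lra | exact Hy].
      - apply expands_growth with y; auto; [|apply Hexp; lra].
        apply Hdist1; [apply Hw; lra | exact Hy]. }
    assert (He : expands g (w u) y).
    { apply growth_expands with (2 * Ky) (2 * B); try assumption; try lra.
      - apply Hdist; [exact Hy | apply Hw; lra].
      - intros s Hs. replace (w u + s * (y - w u)) with (w (u + s * (1 - u))) by (unfold w; ring).
        apply Hbd. nra. }
    apply expands_growth with (w u); auto. }
  intros c z Hc Hz.
  apply growth_expands with (2 * K) (2 * B); try assumption; try lra.
  - apply Hdist; assumption.
  - intros s Hs. apply Hunif, Hconv; assumption.
Qed.

Lemma nested_intervals (u v : nat -> R) :
  (forall n, u n <= v n) -> (forall n, u n <= u (S n)) -> (forall n, v (S n) <= v n) ->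
  exists x, forall n, u n <= x <= v n.
Proof.
  intros Huv Hu Hv.
  assert (Hum : forall n k, u n <= u (n + k)%nat).
  { intros n k. induction k as [|k IH]; [rewrite Nat.add_0_r; lra|].
    replace (n + S k)%nat with (S (n + k)) by lia. specialize (Hu (n + k)%nat). lra. }
  assert (Hvm : forall n k, v (n + k)%nat <= v n).
  { intros n k. induction k as [|k IH]; [rewrite Nat.add_0_r; lra|].
    replace (n + S k)%nat with (S (n + k)) by lia. specialize (Hv (n + k)%nat). lra. }
  assert (Hcross : forall n m, u n <= v m).
  { intros n m. specialize (Hum n m). specialize (Hvm m n). specialize (Huv (n + m)%nat).
    rewrite (Nat.add_comm m n) in Hvm. lra. }
  destruct (completeness (fun x => exists n, x = u n)) as [x [Hub Hlub]].
  - exists (v 0%nat). intros y [n ->]. apply Hcross.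
  - exists (u 0%nat), 0%nat. reflexivity.
  - exists x. intros n. split.
    + apply Hub. exists n. reflexivity.
    + apply Hlub. intros y [m ->]. apply Hcross.
Qed.

(** Baire's argument, carried out with nested intervals: were some interval bad,
    [expands_on_of_dense_growth] would give inside each bad interval another
    one, in which no point satisfies the estimate with constant [n].  A common
    point of all of them satisfies no estimate at all, against the
    hypothesis. *)
Theorem pringsheim (g : R -> R) :
  infinitely_derivable g ->
  (forall B x, 0 < B -> exists K, growth g K B x) ->
  forall c z, expands g c z.
Proof.
  intros Hg Hpt c0 z0.
  set (a := Rmin c0 z0). set (b := Rmax c0 z0).
  assert (Hab : a <= b) by (unfold a, b; apply Rle_trans with c0; [apply Rmin_l | apply Rmax_l]).
  apply NNPP. intros Hnot.
  assert (Hbad : ~ expands_on g a b).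
  { intros H. apply Hnot, H; split; unfold a, b; auto using Rmin_l, Rmin_r, Rmax_l, Rmax_r. }
  clear Hnot.
  (* The rate is doubled once, and an expansion at rate [2 * B] needs
     [4 * (2 * B) * (b - a) <= 1]; the added 1 covers [a = b]. *)
  set (B := / (8 * (b - a + 1))).
  assert (HB : 0 < B) by (apply Rinv_0_lt_compat; lra).
  assert (HBs : 8 * B * (b - a) <= 1).
  { unfold B. replace (8 * / (8 * (b - a + 1)) * (b - a)) with ((b - a) / (b - a + 1)) by (field; lra).
    apply Rle_div_l; lra. }
  set (bad := fun I : R * R =>
    a <= fst I /\ fst I <= snd I /\ snd I <= b /\ ~ expands_on g (fst I) (snd I)).
  set (inside := fun (n : nat) (I J : R * R) =>
    fst I <= fst J /\ snd J <= snd I /\ forall x, fst J <= x <= snd J -> ~ growth g (INR n) B x).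
  assert (Hstep : forall (n : nat) (I : {I | bad I}), exists J : {I | bad I},
    inside n (proj1_sig I) (proj1_sig J)).
  { intros n [I HI]. simpl. apply NNPP. intros Hno. destruct HI as [H1 [H2 [H3 H4]]].
    apply H4. apply expands_on_of_dense_growth with (INR n) B; try assumption; try lra.
    - apply pos_INR.
    - apply Rle_trans with (8 * B * (b - a)); [|exact HBs]. apply Rmult_le_compat_l; lra.
    - intros x _. apply Hpt, HB.
    - intros a' b' Ha' Hab' Hb' Hbad'. apply NNPP. intros Hno'. apply Hno.
      assert (HJ : bad (a', b')) by (unfold bad; simpl; repeat split; try assumption; lra).
      exists (exist _ _ HJ). unfold inside; simpl. repeat split; try lra.
      intros x Hx Hgr. apply Hno'. exists x. split; assumption. }
  set (next := fun n I => proj1_sig (constructive_indefinite_description _ (Hstep n I))).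
  assert (Hnext : forall n I, inside n (proj1_sig I) (proj1_sig (next n I))).
  { intros n I. exact (proj2_sig (constructive_indefinite_description _ (Hstep n I))). }
  assert (H0 : bad (a, b)) by (unfold bad; simpl; repeat split; try assumption; lra).
  set (I := fix I (n : nat) : {I | bad I} :=
    match n with O => exist _ _ H0 | S n' => next n' (I n') end).
  assert (HI : forall n, inside n (proj1_sig (I n)) (proj1_sig (I (S n)))).
  { intros n. apply Hnext. }
  destruct (nested_intervals (fun n => fst (proj1_sig (I n))) (fun n => snd (proj1_sig (I n))))
    as [x Hx].
  - intros n. apply (proj2_sig (I n)).
  - intros n. apply HI.
  - intros n. apply HI.
  - destruct (Hpt B x HB) as [K HK].
    destruct (nfloor_ex (Rmax K 0) (Rmax_r _ _)) as [n Hn].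
    destruct (HI (S n)) as [_ [_ Hout]]. apply (Hout x (Hx (S (S n)))).
    apply growth_weaken with (Rmax K 0) B; [|lra|].
    + rewrite S_INR. split; [apply Rmax_r | lra].
    + intros k. eapply Rle_trans; [apply HK|].
      apply Rmult_le_compat_r; [apply pow_le; lra|].
      apply Rmult_le_compat_r; [apply pos_INR | apply Rmax_l].
Qed.

(** * Continuity, integrals and a parameter *)

Section Continuity.
Context {U : UniformSpace}.
Implicit Types F G : U -> R.

Lemma cont_mult F G : (forall m, continuous F m) -> (forall m, continuous G m) ->
  forall m, continuous (fun m => F m * G m) m.
Proof. intros HF HG m. apply (continuous_mult (K := R_AbsRing) F G m (HF m) (HG m)). Qed.

Lemma cont_plus F G : (forall m, continuous F m) -> (forall m, continuous G m) ->
  forall m, continuous (fun m => F m + G m) m.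
Proof. intros HF HG m. apply (continuous_plus (V := R_NormedModule) F G m (HF m) (HG m)). Qed.

Lemma cont_minus F G : (forall m, continuous F m) -> (forall m, continuous G m) ->
  forall m, continuous (fun m => F m - G m) m.
Proof. intros HF HG m. apply (continuous_minus (V := R_NormedModule) F G m (HF m) (HG m)). Qed.

Lemma cont_opp F : (forall m, continuous F m) -> forall m, continuous (fun m => - F m) m.
Proof. intros HF m. apply (continuous_opp (V := R_NormedModule) F m (HF m)). Qed.

Lemma cont_const (c : R) : forall m : U, continuous (fun _ => c) m.
Proof. intros m. apply continuous_const. Qed.

Lemma cont_comp (h : R -> R) F : (forall x, continuous h x) -> (forall m, continuous F m) ->
  forall m, continuous (fun m => h (F m)) m.
Proof. intros Hh HF m. apply (continuous_comp F h m (HF m) (Hh _)). Qed.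
End Continuity.

Lemma cont_fst (m : R * R) : continuous (fun m : R * R => fst m) m.
Proof. destruct m. apply continuous_fst. Qed.
Lemma cont_snd (m : R * R) : continuous (fun m : R * R => snd m) m.
Proof. destruct m. apply continuous_snd. Qed.
Lemma cont_id (x : R) : continuous (fun x : R => x) x.
Proof. apply continuous_id. Qed.
Lemma cont_derive (h h1 : R -> R) :
  (forall x, is_derive h x (h1 x)) -> forall x, continuous h x.
Proof. intros H x. apply @ex_derive_continuous. eexists; apply H. Qed.
Lemma cont_cos (x : R) : continuous cos x.
Proof. apply continuous_cos. Qed.
Lemma cont_sin (x : R) : continuous sin x.
Proof. apply continuous_sin. Qed.
Lemma cont_exp (x : R) : continuous exp x.
Proof. apply continuous_exp. Qed.

Ltac cont_step :=
  first [ assumption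
        | exact cont_fst | exact cont_snd | exact cont_id | exact cont_cos | exact cont_sin
        | exact cont_exp
        | match goal with
          | |- forall m, continuous (fun x => @?F x * @?G x) m => apply (cont_mult F G)
          | |- forall m, continuous (fun x => @?F x + @?G x) m => apply (cont_plus F G)
          | |- forall m, continuous (fun x => @?F x - @?G x) m => apply (cont_minus F G)
          | |- forall m, continuous (fun x => - @?F x) m => apply (cont_opp F)
          end
        | apply cont_const
        | match goal with
          | |- forall m, continuous (fun x => ?h (@?F x)) m => apply (cont_comp h F)
          end ].
Ltac cont := repeat cont_step.

Lemma ex_RInt_cont (h : R -> R) (a b : R) : (forall x, continuous h x) -> ex_RInt h a b.
Proof. intros H. apply @ex_RInt_continuous. intros z _. apply H. Qed.

Lemma is_RInt_cont (h : R -> R) (a b : R) : (forall x, continuous h x) -> is_RInt h a b (RInt h a b).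
Proof. intros H. apply (RInt_correct (V := R_CompleteNormedModule)), ex_RInt_cont, H. Qed.

Lemma RInt_mult_const (h : R -> R) (c a b : R) :
  (forall x, continuous h x) -> RInt (fun x => c * h x) a b = c * RInt h a b.
Proof. intros H. apply (RInt_scal (V := R_CompleteNormedModule) h a b c), ex_RInt_cont, H. Qed.

Lemma RInt_add (f g : R -> R) (a b : R) :
  (forall x, continuous f x) -> (forall x, continuous g x) ->
  RInt (fun x => f x + g x) a b = RInt f a b + RInt g a b.
Proof.
  intros Hf Hg. apply (RInt_plus (V := R_CompleteNormedModule) f g); apply ex_RInt_cont; assumption.
Qed.

Lemma FTC (h h1 : R -> R) (a b : R) :
  (forall x, is_derive h x (h1 x)) -> (forall x, continuous h1 x) ->
  RInt h1 a b = h b - h a.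
Proof.
  intros H Hc. apply is_RInt_unique.
  apply (is_RInt_derive (V := R_CompleteNormedModule) h h1); auto.
Qed.

Lemma abs_RInt_le_RInt (f g : R -> R) (a b : R) :
  a <= b -> (forall x, continuous f x) -> (forall x, continuous g x) ->
  (forall x, a <= x <= b -> Rabs (f x) <= g x) -> Rabs (RInt f a b) <= RInt g a b.
Proof.
  intros Hab Hf Hg Hle.
  apply (norm_RInt_le (V := R_NormedModule) f g a b); auto using is_RInt_cont.
Qed.

(** Differentiation under the integral sign; this is how primitives in the
    frequency variable and derivatives of Fourier integrals are computed. *)
Lemma is_derive_RInt_parameter (phi phi1 : R -> R -> R) (a b p : R) :
  (forall p t, is_derive (fun u => phi u t) p (phi1 p t)) ->
  (forall m : R * R, continuous (fun m : R * R => phi1 (fst m) (snd m)) m) ->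
  (forall p t, continuous (phi p) t) ->
  is_derive (fun p => RInt (phi p) a b) p (RInt (phi1 p) a b).
Proof.
  intros Hd Hc1 Hc.
  replace (RInt (phi1 p) a b) with (RInt (fun t => Derive (fun u => phi u t) p) a b).
  - apply (is_derive_RInt_param phi).
    + apply filter_forall. intros x t _. eexists; apply Hd.
    + intros t _. apply continuity_2d_pt_ext with phi1.
      { intros x y. symmetry. apply is_derive_unique, Hd. }
      apply continuity_2d_pt_filterlim. apply (Hc1 (p, t)).
    + apply filter_forall. intros y. apply ex_RInt_cont, Hc.
  - apply RInt_ext. intros t _. apply is_derive_unique, Hd.
Qed.

Lemma cont_partial (f : R * R -> R) (q : R) :
  (forall m, continuous f m) -> forall x, continuous (fun x => f (x, q)) x.
Proof.
  intros H x. apply (continuous_comp_2 (fun x => x) (fun _ => q) (fun a b => f (a, b))).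
  - apply continuous_id.
  - apply continuous_const.
  - apply continuous_ext with f. { intros [? ?]; reflexivity. } apply H.
Qed.

(** The quotient [(h z - h 0) / z] as the integral of [h' (t z)] for [t] in
    [0, 1]: in this form it has no exceptional point and inherits the smoothness
    of [h']. *)
Definition hadamard_quotient (h1 : R -> R) (z : R) := RInt (fun t => h1 (t * z)) 0 1.

Lemma hadamard_quotient_eq (h h1 : R -> R) (z : R) :
  (forall x, is_derive h x (h1 x)) -> (forall x, continuous h1 x) ->
  z * hadamard_quotient h1 z = h z - h 0.
Proof.
  intros H Hc. unfold hadamard_quotient.
  replace (h z - h 0) with (h (1 * z) - h (0 * z)) by (f_equal; f_equal; ring).
  rewrite <- (FTC (fun t => h (t * z)) (fun t => z * h1 (t * z))).
  - symmetry. apply RInt_mult_const. cont.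
  - intros t. evar_last.
    { apply (is_derive_comp h (fun t => t * z)); [apply H | auto_derive; [exact I | reflexivity]]. }
    unfold scal; simpl; unfold mult; simpl. ring.
  - cont.
Qed.

Lemma is_derive_hadamard_quotient (h1 h2 : R -> R) (z : R) :
  (forall x, is_derive h1 x (h2 x)) -> (forall x, continuous h2 x) ->
  is_derive (hadamard_quotient h1) z (RInt (fun t => t * h2 (t * z)) 0 1).
Proof.
  intros H Hc. assert (Hc1 := cont_derive h1 h2 H).
  apply (is_derive_RInt_parameter (fun z t => h1 (t * z)) (fun z t => t * h2 (t * z))).
  - intros p t. evar_last.
    { apply (is_derive_comp h1 (fun u => t * u)); [apply H | auto_derive; [exact I | reflexivity]]. }
    unfold scal; simpl; unfold mult; simpl. ring.
  - cont.
  - intros p. cont.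
Qed.

Lemma continuous_derive_hadamard_quotient (h2 h3 : R -> R) (z : R) :
  (forall x, is_derive h2 x (h3 x)) -> (forall x, continuous h3 x) ->
  continuous (fun z => RInt (fun t => t * h2 (t * z)) 0 1) z.
Proof.
  intros H Hc. assert (Hc1 := cont_derive h2 h3 H).
  apply @ex_derive_continuous. eexists.
  apply (is_derive_RInt_parameter (fun z t => t * h2 (t * z)) (fun z t => t * (t * h3 (t * z)))).
  - intros p t. evar_last.
    { apply is_derive_scal.
      apply (is_derive_comp h2 (fun u => t * u)); [apply H | auto_derive; [exact I | reflexivity]]. }
    unfold scal; simpl; unfold mult; simpl. ring.
  - cont.
  - intros p. cont.
Qed.

Lemma inverse_decay (I : R -> R) (C : R) :
  (forall p, Rabs (p * I p) <= C) ->
  filterlim I (Rbar_locally p_infty) (locally 0) /\ filterlim I (Rbar_locally m_infty) (locally 0).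
Proof.
  intros H.
  assert (HC : 0 <= C) by (specialize (H 0); pose proof (Rabs_pos (0 * I 0)); lra).
  assert (Hb : forall eps : posreal, forall p, (C + 1) / eps < Rabs p -> Rabs (I p - 0) < eps).
  { intros eps p Hp. rewrite Rminus_0_r. specialize (H p). rewrite Rabs_mult in H.
    apply Rlt_div_l in Hp; [|apply cond_pos].
    assert (H1 := cond_pos eps). assert (H2 := Rabs_pos (I p)). assert (H3 := Rabs_pos p).
    apply Rnot_le_lt. intros Hle. nra. }
  assert (Hpos : forall eps : posreal, 0 < (C + 1) / eps).
  { intros eps. apply Rdiv_lt_0_compat; [lra | apply cond_pos]. }
  split; apply filterlim_locally; intros eps; specialize (Hb eps); specialize (Hpos eps).
  - exists ((C + 1) / eps). intros p Hp. apply Hb. rewrite Rabs_pos_eq; lra.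
  - exists (- ((C + 1) / eps)). intros p Hp. apply Hb. rewrite Rabs_left; lra.
Qed.

(** Integration by parts; [s] and [c] stand for [sin] and [cos], or for [- cos]
    and [sin]. *)
Lemma riemann_lebesgue (s c k k1 : R -> R) (a b : R) :
  (forall x, is_derive s x (c x)) -> (forall x, continuous c x) -> (forall x, Rabs (s x) <= 1) ->
  (forall x, is_derive k x (k1 x)) -> (forall x, continuous k1 x) -> a <= b ->
  exists C, forall p, Rabs (p * RInt (fun z => k z * c (p * z)) a b) <= C.
Proof.
  intros Hs Hc Hs1 Hk Hk1 Hab.
  assert (Hcs := cont_derive s c Hs). assert (Hck := cont_derive k k1 Hk).
  exists (Rabs (k b) + Rabs (k a) + RInt (fun z => Rabs (k1 z)) a b). intros p.
  assert (E : p * RInt (fun z => k z * c (p * z)) a b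
    = k b * s (p * b) - k a * s (p * a) - RInt (fun z => k1 z * s (p * z)) a b).
  { rewrite <- (FTC (fun z => k z * s (p * z)) (fun z => p * (k z * c (p * z)) + k1 z * s (p * z))).
    - rewrite RInt_add by cont. rewrite RInt_mult_const by cont. ring.
    - intros x. evar_last.
      { apply (is_derive_mult (K := R_AbsRing) k (fun z => s (p * z)) x (k1 x) (p * c (p * x))).
        - apply Hk.
        - evar_last. { apply (is_derive_comp s (fun z => p * z)); [apply Hs | auto_derive; [exact I | reflexivity]]. }
          unfold scal; simpl; unfold mult; simpl. ring.
        - intros n m. apply Rmult_comm. }
      unfold plus, mult; simpl. ring.
    - cont. }
  rewrite E.
  assert (HR : Rabs (RInt (fun z => k1 z * s (p * z)) a b) <= RInt (fun z => Rabs (k1 z)) a b).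
  { apply abs_RInt_le_RInt; [exact Hab | cont | |].
    - apply (cont_comp Rabs); [exact continuous_Rabs | assumption].
    - intros x _. rewrite Rabs_mult. assert (H1 := Hs1 (p * x)). assert (H2 := Rabs_pos (k1 x)). nra. }
  assert (Hkb : Rabs (k b * s (p * b)) <= Rabs (k b)).
  { rewrite Rabs_mult. assert (H1 := Hs1 (p * b)). assert (H2 := Rabs_pos (k b)). nra. }
  assert (Hka : Rabs (k a * s (p * a)) <= Rabs (k a)).
  { rewrite Rabs_mult. assert (H1 := Hs1 (p * a)). assert (H2 := Rabs_pos (k a)). nra. }
  unfold Rminus. eapply Rle_trans; [apply Rabs_triang|]. rewrite Rabs_Ropp.
  apply Rplus_le_compat; [|exact HR].
  eapply Rle_trans; [apply Rabs_triang|]. rewrite Rabs_Ropp. lra.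
Qed.

(** * The Dirichlet integral *)

(** [sin z / z], extended by 1 at 0. *)
Definition sinc := hadamard_quotient cos.

Lemma sinc_eq (z : R) : z * sinc z = sin z.
Proof.
  unfold sinc. rewrite (hadamard_quotient_eq sin cos).
  - rewrite sin_0. ring.
  - apply is_derive_sin.
  - apply continuous_cos.
Qed.

Lemma cont_sinc (z : R) : continuous sinc z.
Proof.
  apply @ex_derive_continuous. eexists.
  apply (is_derive_hadamard_quotient cos (fun x => - sin x)).
  - apply is_derive_cos.
  - cont.
Qed.

Lemma sinc_bound (z : R) : Rabs (sinc z) <= 1.
Proof.
  replace 1 with (RInt (fun _ => 1) 0 1) at 1.
  2:{ rewrite RInt_const. unfold scal; simpl; unfold mult; simpl. ring. }
  apply abs_RInt_le_RInt; [lra | cont | cont |].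
  intros x _. apply Rabs_le. apply COS_bound.
Qed.

Lemma filterlim_atan : filterlim atan (Rbar_locally p_infty) (locally (PI / 2)).
Proof.
  apply filterlim_locally. intros eps.
  set (e := Rmin (eps / 2) (PI / 4)).
  assert (HPI := PI_RGT_0). assert (He0 := cond_pos eps).
  assert (He : 0 < e) by (apply Rmin_pos; lra).
  assert (He1 : e <= eps / 2) by apply Rmin_l. assert (He2 : e <= PI / 4) by apply Rmin_r.
  exists (tan (PI / 2 - e)). intros x Hx.
  assert (H1 := atan_bound x).
  assert (H2 : PI / 2 - e < atan x).
  { rewrite <- (atan_tan (PI / 2 - e)) by lra. apply atan_increasing, Hx. }
  change (Rabs (atan x - PI / 2) < eps). apply Rabs_def1; lra.
Qed.

Definition Si (T : R) := RInt sinc 0 T.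

Lemma laplace_sin (s T : R) :
  RInt (fun z => exp (- s * z) * sin z) 0 T
  = (1 - exp (- s * T) * (cos T + s * sin T)) / (1 + s * s).
Proof.
  assert (Hs : 1 + s * s <> 0) by nra.
  rewrite (FTC (fun z => - exp (- s * z) * (cos z + s * sin z) / (1 + s * s))).
  - rewrite Rmult_0_r, exp_0, cos_0, sin_0. in_R. field. exact Hs.
  - intros x. auto_derive; [exact I | field; exact Hs].
  - cont.
Qed.

(** Regularize by [I s], the integral of [exp (- s z) sinc z] over [0, T].  Its
    derivative in [s] is elementary and differs from that of [- atan] by at most
    [2 exp (- s T)], so that [Si T = I 0] is within [2 / T] of [I T + atan T],
    while [I T] is at most [/ T]. *)
Lemma Si_atan (T : R) : 0 < T -> Rabs (Si T - atan T) <= 3 / T.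
Proof.
  intros HT.
  set (I := fun s => RInt (fun z => exp (- s * z) * sinc z) 0 T).
  set (e := fun s => exp (- s * T) * (cos T + s * sin T) / (1 + s * s)).
  assert (Hsc := cont_sinc).
  assert (Hden : forall s, 0 < 1 + s * s) by (intros; nra).
  assert (HI : forall s, is_derive I s (- RInt (fun z => exp (- s * z) * sin z) 0 T)).
  { intros s. evar_last.
    - apply (is_derive_RInt_parameter (fun s z => exp (- s * z) * sinc z)
        (fun s z => (- 1) * (exp (- s * z) * sin z))).
      + intros p t. rewrite <- (sinc_eq t). auto_derive; [exact Logic.I | ring].
      + cont.
      + intros p. cont.
    - simpl. rewrite RInt_mult_const by cont. ring. }
  assert (HJ : forall s, is_derive (fun s => I s + atan s) s (e s)).
  { intros s. evar_last.
    - apply (is_derive_plus (V := R_NormedModule) I atan); [apply HI | apply is_derive_atan].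
    - simpl. rewrite laplace_sin. unfold plus, e, Rsqr; simpl. field. specialize (Hden s). lra. }
  assert (Hinv : forall s, continuous (fun s => / (1 + s * s)) s).
  { intros s. apply @ex_derive_continuous. auto_derive. specialize (Hden s). lra. }
  assert (He : forall s, continuous e s).
  { unfold e, Rdiv. cont. }
  assert (HE : Rabs (RInt e 0 T) <= 2 / T).
  { apply Rle_trans with (RInt (fun s => 2 * exp (- s * T)) 0 T).
    - apply abs_RInt_le_RInt; [lra | exact He | cont |].
      intros s Hs. unfold e, Rdiv. rewrite !Rabs_mult.
      rewrite (Rabs_pos_eq (exp _)) by (left; apply exp_pos).
      rewrite (Rabs_pos_eq (/ _)) by (left; apply Rinv_0_lt_compat, Hden).
      assert (Hcs : Rabs (cos T + s * sin T) <= 1 + s).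
      { eapply Rle_trans; [apply Rabs_triang|]. rewrite Rabs_mult, (Rabs_pos_eq s) by lra.
        assert (H1 : Rabs (cos T) <= 1) by (apply Rabs_le, COS_bound).
        assert (H2 : Rabs (sin T) <= 1) by (apply Rabs_le, SIN_bound). nra. }
      rewrite Rmult_assoc, (Rmult_comm 2). apply Rmult_le_compat_l; [left; apply exp_pos|].
      apply Rle_div_l; [apply Hden|]. nra.
    - rewrite (FTC (fun s => - 2 / T * exp (- s * T))).
      + rewrite Ropp_0, Rmult_0_l, exp_0.
        assert (0 < / T) by (apply Rinv_0_lt_compat, HT).
        assert (He0 := exp_pos (- T * T)). unfold Rdiv. nra.
      + intros x. auto_derive; [exact Logic.I | field; lra].
      + cont. }
  rewrite (FTC (fun s => I s + atan s) e 0 T HJ He), atan_0, Rplus_0_r in HE.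
  assert (HI0 : I 0 = Si T).
  { unfold I, Si. apply RInt_ext. intros x _. rewrite Ropp_0, Rmult_0_l, exp_0. in_R. ring. }
  assert (HIT : Rabs (I T) <= / T).
  { apply Rle_trans with (RInt (fun z => exp (- T * z)) 0 T).
    - apply abs_RInt_le_RInt; [lra | cont | cont |].
      intros x _. rewrite Rabs_mult, Rabs_pos_eq by (left; apply exp_pos).
      assert (H1 := sinc_bound x). assert (H2 := exp_pos (- T * x)). nra.
    - rewrite (FTC (fun z => - / T * exp (- T * z))).
      + rewrite Rmult_0_r, exp_0.
        assert (0 < / T) by (apply Rinv_0_lt_compat, HT).
        assert (He0 := exp_pos (- T * T)). nra.
      + intros x. auto_derive; [exact Logic.I | field; lra].
      + cont. }
  rewrite HI0 in HE.
  replace (Si T - atan T) with (I T - (I T + atan T - Si T)) by ring.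
  unfold Rminus at 1. eapply Rle_trans; [apply Rabs_triang|]. rewrite Rabs_Ropp.
  replace (3 / T) with (/ T + 2 / T) by (field; lra). lra.
Qed.

Lemma filterlim_Si : filterlim Si (Rbar_locally p_infty) (locally (PI / 2)).
Proof.
  apply filterlim_locally. intros eps.
  assert (Hat := proj1 (filterlim_locally atan (PI / 2)) filterlim_atan (pos_div_2 eps)).
  destruct Hat as [M HM].
  assert (He := cond_pos eps).
  exists (Rmax M (6 / eps)). intros T HT.
  assert (HT1 : M < T) by (eapply Rle_lt_trans; [apply Rmax_l | exact HT]).
  assert (HT2 : 6 / eps < T) by (eapply Rle_lt_trans; [apply Rmax_r | exact HT]).
  assert (0 < 6 / eps) by (apply Rdiv_lt_0_compat; lra).
  assert (HS := Si_atan T ltac:(lra)). specialize (HM T HT1).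
  change (Rabs (atan T - PI / 2) < eps / 2) in HM. change (Rabs (Si T - PI / 2) < eps).
  assert (H3 : 3 / T <= eps / 2).
  { apply Rle_div_l; [lra|]. apply Rlt_div_l in HT2; lra. }
  replace (Si T - PI / 2) with ((Si T - atan T) + (atan T - PI / 2)) by ring.
  eapply Rle_lt_trans; [apply Rabs_triang|]. lra.
Qed.

Lemma sinc_even (z : R) : sinc (- z) = sinc z.
Proof.
  apply RInt_ext. intros t _. replace (t * - z) with (- (t * z)) by ring. apply cos_neg.
Qed.

Lemma Si_odd (T : R) : Si (- T) = - Si T.
Proof.
  assert (H := RInt_comp_lin (V := R_CompleteNormedModule) sinc (-1) 0 0 T).
  unfold Si. replace (-1 * 0 + 0) with 0 in H by ring. replace (-1 * T + 0) with (- T) in H by ring.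
  rewrite <- H by (apply ex_RInt_cont, cont_sinc).
  rewrite (RInt_ext _ (fun z => (-1) * sinc z)).
  - rewrite RInt_mult_const by apply cont_sinc. in_R. ring.
  - intros x _. unfold scal; simpl; unfold mult; simpl.
    replace (-1 * x + 0) with (- x) by ring. rewrite sinc_even. reflexivity.
Qed.

Lemma is_derive_Si (T : R) : is_derive Si T (sinc T).
Proof.
  apply (is_derive_RInt (V := R_NormedModule) sinc Si 0).
  - apply filter_forall. intros x. apply is_RInt_cont, cont_sinc.
  - apply cont_sinc.
Qed.

Lemma RInt_cos_symmetric (p L : R) : RInt (fun z => cos (p * z)) (- L) L = 2 * (L * sinc (L * p)).
Proof.
  assert (Hhalf : forall K, RInt (fun z => cos (p * z)) 0 K = K * sinc (K * p)).
  { intros K. destruct (Req_dec p 0) as [->|Hp].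
    - rewrite (RInt_ext _ (fun _ => 1)), RInt_const.
      + unfold scal; simpl; unfold mult; simpl. unfold sinc, hadamard_quotient.
        rewrite (RInt_ext _ (fun _ => 1)), RInt_const.
        * unfold scal; simpl; unfold mult; simpl. in_R. ring.
        * intros x _. rewrite !Rmult_0_r. apply cos_0.
      + intros x _. rewrite !Rmult_0_l. apply cos_0.
    - rewrite (FTC (fun z => sin (p * z) / p)).
      + rewrite Rmult_0_r, sin_0, (Rmult_comm p K), <- sinc_eq. in_R. field. exact Hp.
      + intros x. auto_derive; [exact I | field; exact Hp].
      + cont. }
  rewrite <- (RInt_Chasles (V := R_CompleteNormedModule) _ (- L) 0 L) by (apply ex_RInt_cont; cont).
  rewrite <- (opp_RInt_swap (V := R_CompleteNormedModule) _ 0 (- L)) by (apply ex_RInt_cont; cont).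
  rewrite !Hhalf. replace (- L * p) with (- (L * p)) by ring. rewrite sinc_even.
  unfold plus, opp; simpl. in_R. ring.
Qed.

Lemma RInt_sin_symmetric (p L : R) : RInt (fun z => sin (p * z)) (- L) L = 0.
Proof.
  destruct (Req_dec p 0) as [->|Hp].
  - rewrite (RInt_ext _ (fun _ => 0)), RInt_const.
    + unfold scal; simpl; unfold mult; simpl. in_R. ring.
    + intros x _. rewrite Rmult_0_l. apply sin_0.
  - rewrite (FTC (fun z => - cos (p * z) / p)).
    + replace (p * - L) with (- (p * L)) by ring. rewrite cos_neg. in_R. field. exact Hp.
    + intros x. auto_derive; [exact I | field; exact Hp].
    + cont.
Qed.

Lemma is_RInt_gen_antiderivative (h h1 : R -> R) (la lb : R) :
  (forall x, is_derive h x (h1 x)) -> (forall x, continuous h1 x) ->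
  filterlim h (Rbar_locally m_infty) (locally la) ->
  filterlim h (Rbar_locally p_infty) (locally lb) ->
  is_RInt_gen h1 (Rbar_locally m_infty) (Rbar_locally p_infty) (lb - la).
Proof.
  intros H Hc Ha Hb.
  apply is_RInt_gen_ext with (Derive h).
  { apply filter_forall. intros ab x _. apply is_derive_unique, H. }
  apply is_RInt_gen_Derive; try assumption; apply filter_forall; intros ab x _.
  - eexists; apply H.
  - apply continuous_ext with h1; [|apply Hc]. intros y. symmetry. apply is_derive_unique, H.
Qed.

Lemma filterlim_Rplus {T} (F : (T -> Prop) -> Prop) {FF : Filter F} (f g : T -> R) (a b : R) :
  filterlim f F (locally a) -> filterlim g F (locally b) ->
  filterlim (fun t => f t + g t) F (locally (a + b)).
Proof.
  intros Hf Hg. eapply filterlim_comp_2; [exact Hf | exact Hg |].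
  apply (filterlim_plus (V := R_NormedModule)).
Qed.

Lemma filterlim_Rscal {T} (F : (T -> Prop) -> Prop) (f : T -> R) (c a : R) :
  filterlim f F (locally a) -> filterlim (fun t => c * f t) F (locally (c * a)).
Proof.
  intros Hf. eapply filterlim_comp; [exact Hf|].
  apply (filterlim_scal_r (V := R_NormedModule)).
Qed.

Lemma filterlim_scale_infty (L : R) : 0 < L ->
  filterlim (fun p => L * p) (Rbar_locally p_infty) (Rbar_locally p_infty)
  /\ filterlim (fun p => - (L * p)) (Rbar_locally m_infty) (Rbar_locally p_infty).
Proof.
  intros HL. split; intros P [M HM].
  - exists (M / L). intros p Hp. apply HM. apply Rlt_div_l in Hp; lra.
  - exists (- (M / L)). intros p Hp. apply HM.
    assert (H : M / L < - p) by lra. apply Rlt_div_l in H; lra.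
Qed.

(** * Fourier inversion at a point *)

Section Inversion.
Variables (h h1 h2 h3 : R -> R) (L : R).
Hypothesis Hh : forall x, is_derive h x (h1 x).
Hypothesis Hh1 : forall x, is_derive h1 x (h2 x).
Hypothesis Hh2 : forall x, is_derive h2 x (h3 x).
Hypothesis Hh3 : forall x, continuous h3 x.
Hypothesis HL : 0 < L.

Let k := hadamard_quotient h1.
Let k1 := fun z => RInt (fun t => t * h2 (t * z)) 0 1.

Let Hk (z : R) : is_derive k z (k1 z).
Proof. apply is_derive_hadamard_quotient; [exact Hh1 | exact (cont_derive h2 h3 Hh2)]. Qed.

Let Hk1 (z : R) : continuous k1 z.
Proof. apply continuous_derive_hadamard_quotient with h3; assumption. Qed.

Let Hkc : forall z, continuous k z := cont_derive k k1 Hk.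

Let h_decomposition (z : R) : h z = h 0 + z * k z.
Proof.
  unfold k. rewrite (hadamard_quotient_eq h h1); [ring | exact Hh | exact (cont_derive h1 h2 Hh1)].
Qed.

(** The integral over [- L, L] of [h z cos (p z)] is the derivative in [p] of
    [2 h(0) Si (L p) + K p], where [K] tends to 0 at both ends. *)
Lemma fourier_inversion_cos :
  is_RInt_gen (fun p => RInt (fun z => h z * cos (p * z)) (- L) L)
    (Rbar_locally m_infty) (Rbar_locally p_infty) (2 * PI * h 0).
Proof.
  assert (Hsc := cont_sinc). assert (Hhc := cont_derive h h1 Hh).
  set (K := fun p => RInt (fun z => k z * sin (p * z)) (- L) L).
  assert (HK : filterlim K (Rbar_locally p_infty) (locally 0)
               /\ filterlim K (Rbar_locally m_infty) (locally 0)).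
  { destruct (riemann_lebesgue (fun x => - cos x) sin k k1 (- L) L) as [C HC]; try assumption; try lra.
    - intros x. auto_derive; [exact I | ring].
    - exact cont_sin.
    - intros x. rewrite Rabs_Ropp. apply Rabs_le, COS_bound.
    - exact (inverse_decay K C HC). }
  assert (Hd : forall p, is_derive (fun p => 2 * h 0 * Si (L * p) + K p) p
                           (RInt (fun z => h z * cos (p * z)) (- L) L)).
  { intros p. evar_last.
    - apply (is_derive_plus (V := R_NormedModule) (fun p => 2 * h 0 * Si (L * p)) K).
      + apply is_derive_scal. apply (is_derive_comp Si (fun p => L * p)).
        * apply is_derive_Si.
        * auto_derive; [exact I | reflexivity].
      + apply (is_derive_RInt_parameter (fun p z => k z * sin (p * z))
          (fun p z => z * k z * cos (p * z))).
        * intros q z. auto_derive; [exact I | ring].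
        * cont.
        * intros q. cont.
    - unfold plus, scal; simpl; unfold mult; simpl.
      rewrite (RInt_ext (fun z => h z * cos (p * z))
        (fun z => h 0 * cos (p * z) + z * k z * cos (p * z))).
      + rewrite RInt_add by cont. rewrite RInt_mult_const by cont.
        rewrite RInt_cos_symmetric. in_R. ring.
      + intros z _. rewrite (h_decomposition z). in_R. ring. }
  destruct (filterlim_scale_infty L HL) as [Hp Hm].
  replace (2 * PI * h 0) with ((2 * h 0 * (PI / 2) + 0) - (2 * h 0 * - (PI / 2) + 0)) by field.
  apply is_RInt_gen_antiderivative with (1 := Hd).
  - intros p. apply @ex_derive_continuous. eexists.
    apply (is_derive_RInt_parameter (fun p z => h z * cos (p * z))
      (fun p z => - z * h z * sin (p * z))).
    + intros q z. auto_derive; [exact I | ring].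
    + cont.
    + intros q. cont.
  - apply (filterlim_Rplus (Rbar_locally m_infty) (fun p => 2 * h 0 * Si (L * p)) K); [|apply HK].
    apply filterlim_Rscal.
    apply filterlim_ext with (fun p => - Si (- (L * p))).
    { intros p. rewrite Si_odd. ring. }
    eapply filterlim_comp; [|apply (filterlim_opp (V := R_NormedModule))].
    eapply filterlim_comp; [exact Hm | exact filterlim_Si].
  - apply (filterlim_Rplus (Rbar_locally p_infty) (fun p => 2 * h 0 * Si (L * p)) K); [|apply HK].
    apply filterlim_Rscal.
    eapply filterlim_comp; [exact Hp | exact filterlim_Si].
Qed.

(** The constant part of [h z = h 0 + z k z] contributes nothing, [sin] being
    odd, and what remains has a primitive vanishing at both ends. *)
Lemma fourier_inversion_sin :
  is_RInt_gen (fun p => RInt (fun z => h z * sin (p * z)) (- L) L)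
    (Rbar_locally m_infty) (Rbar_locally p_infty) 0.
Proof.
  assert (Hhc := cont_derive h h1 Hh).
  set (K := fun p => RInt (fun z => k z * cos (p * z)) (- L) L).
  assert (HK : filterlim K (Rbar_locally p_infty) (locally 0)
               /\ filterlim K (Rbar_locally m_infty) (locally 0)).
  { destruct (riemann_lebesgue sin cos k k1 (- L) L) as [C HC]; try assumption; try lra.
    - exact is_derive_sin.
    - exact cont_cos.
    - intros x. apply Rabs_le, SIN_bound.
    - exact (inverse_decay K C HC). }
  assert (Hd : forall p, is_derive (fun p => (-1) * K p) p
                           (RInt (fun z => h z * sin (p * z)) (- L) L)).
  { intros p. evar_last.
    - apply is_derive_scal.
      apply (is_derive_RInt_parameter (fun p z => k z * cos (p * z))
          (fun p z => (-1) * (z * k z * sin (p * z)))).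
      + intros q z. auto_derive; [exact I | ring].
      + cont.
      + intros q. cont.
    - rewrite RInt_mult_const by cont.
      rewrite (RInt_ext (fun z => h z * sin (p * z))
        (fun z => h 0 * sin (p * z) + z * k z * sin (p * z))).
      + rewrite RInt_add by cont. rewrite RInt_mult_const by cont.
        rewrite RInt_sin_symmetric. in_R. ring.
      + intros z _. rewrite (h_decomposition z). in_R. ring. }
  replace 0 with ((-1) * 0 - (-1) * 0) by ring.
  apply is_RInt_gen_antiderivative with (1 := Hd).
  - intros p. apply @ex_derive_continuous. eexists.
    apply (is_derive_RInt_parameter (fun p z => h z * sin (p * z))
      (fun p z => z * h z * cos (p * z))).
    + intros q z. auto_derive; [exact I | ring].
    + cont.
    + intros q. cont.
  - apply filterlim_Rscal, HK.
  - apply filterlim_Rscal, HK.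
Qed.
End Inversion.

(** * Smooth functions on the plane *)

Lemma is_derive_C (h : R -> C) (t : R) (l : C) :
  is_derive (V := C_R_NormedModule) h t l <->
  is_derive (fun u => Re (h u)) t (Re l) /\ is_derive (fun u => Im (h u)) t (Im l).
Proof.
  split.
  - intros H. split.
    + exact (filterdiff_comp' (V := C_R_NormedModule) (W := R_NormedModule) h fst t _ _ H
        (filterdiff_linear _ is_linear_fst)).
    + exact (filterdiff_comp' (V := C_R_NormedModule) (W := R_NormedModule) h snd t _ _ H
        (filterdiff_linear _ is_linear_snd)).
  - intros [H1 H2].
    assert (Hp := filterdiff_comp'_2 (fun u => Re (h u)) (fun u => Im (h u)) (fun a b => (a, b)) t _ _
      (fun a b => (a, b)) H1 H2
      (filterdiff_linear (fun p : prod_NormedModule R_AbsRing R_NormedModule R_NormedModule => (fst p, snd p))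
        (is_linear_prod _ _ is_linear_fst is_linear_snd))).
    eapply filterdiff_ext_lin; [eapply filterdiff_ext; [|exact Hp]|].
    + intros u. symmetry. apply surjective_pairing.
    + intros y. reflexivity.
Qed.

Lemma continuous_C {U : UniformSpace} (h : U -> C) (m : U) :
  continuous (U := C_R_NormedModule) h m <->
  continuous (fun u => Re (h u)) m /\ continuous (fun u => Im (h u)) m.
Proof.
  split.
  - intros H. split.
    + apply (continuous_comp (V := C_R_NormedModule) (W := R_UniformSpace) h fst m H). apply continuous_fst.
    + apply (continuous_comp (V := C_R_NormedModule) (W := R_UniformSpace) h snd m H). apply continuous_snd.
  - intros [H1 H2].
    apply continuous_ext with (fun u => (Re (h u), Im (h u))).
    { intros u. destruct (h u); reflexivity. }
    apply (continuous_comp_2 (fun u => Re (h u)) (fun u => Im (h u)) (fun a b => (a, b)) m H1 H2).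
    apply continuous_ext with (fun p => p). { intros [? ?]; reflexivity. }
    apply continuous_id.
Qed.

Notation R2 := (prod_NormedModule R_AbsRing R_NormedModule R_NormedModule).
Notation smoothC := (@smooth R2 C_R_NormedModule).

Definition is_directional_derivative (f : R * R -> C) (v : R * R) (g : R * R -> C) :=
  forall m : R * R,
    is_derive (V := C_R_NormedModule) (fun t : R => f (@plus R2 m (@scal _ R2 t v))) 0 (g m).

Definition affine (c0 c1 c2 : C) (m : R * R) : C := (c0 + c1 * RtoC (fst m) + c2 * RtoC (snd m))%C.

Lemma is_derive_Cmult (h k : R -> C) (t : R) (dh dk : C) :
  is_derive (V := C_R_NormedModule) h t dh -> is_derive (V := C_R_NormedModule) k t dk ->
  is_derive (V := C_R_NormedModule) (fun t => h t * k t)%C t (dh * k t + h t * dk)%C.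
Proof.
  intros Hh Hk. apply is_derive_C in Hh, Hk. destruct Hh as [H1 H2], Hk as [K1 K2].
  apply is_derive_C. split.
  - evar_last.
    + apply (is_derive_minus (V := R_NormedModule) (fun t => Re (h t) * Re (k t)) (fun t => Im (h t) * Im (k t))).
      * apply (is_derive_mult (K := R_AbsRing) _ _ _ _ _ H1 K1 Rmult_comm).
      * apply (is_derive_mult (K := R_AbsRing) _ _ _ _ _ H2 K2 Rmult_comm).
    + unfold minus, plus, opp, mult, Re, Im; simpl. ring.
  - evar_last.
    + apply (is_derive_plus (V := R_NormedModule) (fun t => Re (h t) * Im (k t)) (fun t => Im (h t) * Re (k t))).
      * apply (is_derive_mult (K := R_AbsRing) _ _ _ _ _ H1 K2 Rmult_comm).
      * apply (is_derive_mult (K := R_AbsRing) _ _ _ _ _ H2 K1 Rmult_comm).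
    + unfold minus, plus, opp, mult, Re, Im; simpl. ring.
Qed.

Lemma is_derive_affine (c0 c1 c2 : C) (m v : R * R) :
  is_derive (V := C_R_NormedModule) (fun t => affine c0 c1 c2 (@plus R2 m (@scal _ R2 t v))) 0
    (c1 * RtoC (fst v) + c2 * RtoC (snd v))%C.
Proof.
  apply is_derive_ext with
    (fun t : R => affine c0 c1 c2 m + RtoC t * (c1 * RtoC (fst v) + c2 * RtoC (snd v)))%C.
  { intros t. unfold affine. change (fst (@plus R2 m (@scal _ R2 t v))) with (fst m + t * fst v).
    change (snd (@plus R2 m (@scal _ R2 t v))) with (snd m + t * snd v).
    rewrite !RtoC_plus, !RtoC_mult. in_C. ring. }
  apply is_derive_C. unfold Re, Im; simpl. split; auto_derive; try exact I; ring.
Qed.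

(** Directional derivatives of products by affine functions are again sums of
    such products: this closure makes smoothness provable by a single
    induction.  It serves for smooth functions multiplied by [i x], and for the
    derivatives of bump functions. *)
Inductive affine_span (B : (R * R -> C) -> Prop) : (R * R -> C) -> Prop :=
| span_base f : B f -> affine_span B f
| span_plus f g : affine_span B f -> affine_span B g -> affine_span B (fun m => f m + g m)%C
| span_mult c0 c1 c2 f : affine_span B f -> affine_span B (fun m => affine c0 c1 c2 m * f m)%C.

(** The span is made of continuous functions and closed under directional
    derivatives, which is all that the recursion defining smoothness asks for. *)
Lemma smooth_affine_span (B : (R * R -> C) -> Prop) :
  (forall f, B f -> forall m, @continuous R2 C_R_NormedModule f m) ->
  (forall f v, B f -> exists g, is_directional_derivative f v g /\ affine_span B g) ->
  forall f, affine_span B f -> smoothC f.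
Proof.
  intros Hc Hd.
  assert (Hcont : forall f, affine_span B f -> forall m, @continuous R2 C_R_NormedModule f m).
  { intros f Hf. induction Hf as [f Hf | f g _ IHf _ IHg | c0 c1 c2 f _ IHf]; intros m.
    - apply Hc, Hf.
    - apply (continuous_plus (V := C_R_NormedModule) f g m (IHf m) (IHg m)).
    - assert (Hr : forall m, continuous (fun m : R * R => Re (f m)) m)
        by (intros m'; exact (proj1 (proj1 (continuous_C f m') (IHf m')))).
      assert (Hi : forall m, continuous (fun m : R * R => Im (f m)) m)
        by (intros m'; exact (proj2 (proj1 (continuous_C f m') (IHf m')))).
      apply continuous_C. split; revert m; unfold affine, Re, Im in *; simpl; cont. }
  assert (Hder : forall f, affine_span B f -> forall v,
    exists g, is_directional_derivative f v g /\ affine_span B g).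
  { intros f Hf v. induction Hf as [f Hf | f g _ IHf _ IHg | c0 c1 c2 f Hf IHf].
    - apply Hd, Hf.
    - destruct IHf as [f1 [Hf1 Sf1]]. destruct IHg as [g1 [Hg1 Sg1]].
      exists (fun m => f1 m + g1 m)%C. split; [|apply span_plus; assumption].
      intros m. apply (is_derive_plus (V := C_R_NormedModule) _ _ _ _ _ (Hf1 m) (Hg1 m)).
    - destruct IHf as [f1 [Hf1 Sf1]].
      exists (fun m => affine (c1 * RtoC (fst v) + c2 * RtoC (snd v)) 0 0 m * f m + affine c0 c1 c2 m * f1 m)%C.
      split.
      + intros m.
        assert (E : @plus R2 m (@scal _ R2 0 v) = m).
        { destruct m, v. unfold plus, scal; simpl. unfold prod_plus, prod_scal, plus, scal; simpl.
          unfold mult; simpl. f_equal; ring. }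
        evar_last. { exact (is_derive_Cmult _ _ _ _ _ (is_derive_affine c0 c1 c2 m v) (Hf1 m)). }
        cbv beta. rewrite E. unfold affine at 2. in_C. ring.
      + apply span_plus; apply span_mult; assumption. }
  intros f Hf n. revert f Hf. induction n as [|n IH]; intros f Hf.
  - exact (Hcont f Hf).
  - intros v. destruct (Hder f Hf v) as [g [Hg Sg]]. exists g. split; [exact Hg | apply IH, Sg].
Qed.

Lemma is_derive_C_unique (h : R -> C) (t : R) (l l' : C) :
  is_derive (V := C_R_NormedModule) h t l -> is_derive (V := C_R_NormedModule) h t l' -> l = l'.
Proof.
  intros H H'. apply is_derive_C in H, H'. destruct H as [H1 H2], H' as [H1' H2'].
  apply is_derive_unique in H1, H2, H1', H2'. destruct l, l'. simpl in *. congruence.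
Qed.

(** The derivative found at one order of differentiability is the one found at
    every order, by uniqueness; hence it is smooth. *)
Lemma smooth_directional_derivative (f : R * R -> C) (v : R * R) :
  smoothC f -> exists g, is_directional_derivative f v g /\ smoothC g.
Proof.
  intros Hf. destruct (Hf 1%nat v) as [g [Hg _]]. exists g. split; [exact Hg|].
  intros n. destruct (Hf (S n) v) as [g' [Hg' Hn]].
  replace g with g'; [exact Hn|].
  apply functional_extensionality. intros m. exact (is_derive_C_unique _ _ _ _ (Hg' m) (Hg m)).
Qed.

Lemma smooth_span (f : R * R -> C) : affine_span smoothC f -> smoothC f.
Proof.
  apply smooth_affine_span.
  - intros g Hg m. exact (Hg 0%nat m).
  - intros g v Hg. destruct (smooth_directional_derivative g v Hg) as [g' [H1 H2]].
    exists g'. split; [exact H1 | apply span_base, H2].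
Qed.

Lemma smooth_continuous (f : R * R -> C) : smoothC f ->
  (forall m, continuous (fun m : R * R => Re (f m)) m) /\
  (forall m, continuous (fun m : R * R => Im (f m)) m).
Proof.
  intros Hf. split; intros m.
  - exact (proj1 (proj1 (continuous_C f m) (Hf 0%nat m))).
  - exact (proj2 (proj1 (continuous_C f m) (Hf 0%nat m))).
Qed.

Lemma is_derive_translate (h : R -> R) (x l : R) :
  is_derive (fun t => h (x + t)) 0 l -> is_derive h x l.
Proof.
  intros H.
  apply is_derive_ext with (fun y => (fun t => h (x + t)) (y - x)).
  { intros y. simpl. f_equal. ring. }
  evar_last.
  - apply (is_derive_comp (fun t => h (x + t)) (fun y => y - x)).
    + replace (x - x) with 0 by ring. exact H.
    + auto_derive; [exact I | reflexivity].
  - unfold scal; simpl; unfold mult; simpl. ring.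
Qed.

Lemma smooth_D1 (f : R * R -> C) : smoothC f ->
  smoothC (D1 f) /\
  forall x q, is_derive (fun x => Re (f (x, q))) x (Re (D1 f (x, q))) /\
              is_derive (fun x => Im (f (x, q))) x (Im (D1 f (x, q))).
Proof.
  intros Hf. destruct (smooth_directional_derivative f (1, 0) Hf) as [g [Hg Sg]].
  assert (H : forall x q, is_derive (fun x => Re (f (x, q))) x (Re (g (x, q))) /\
              is_derive (fun x => Im (f (x, q))) x (Im (g (x, q)))).
  { intros x q. specialize (Hg (x, q)). apply is_derive_C in Hg. destruct Hg as [H1 H2].
    split; apply is_derive_translate.
    - eapply is_derive_ext; [|exact H1]. intros t. change (Re (f (x + t * 1, q + t * 0)) = Re (f (x + t, q))).
      rewrite Rmult_1_r, Rmult_0_r, Rplus_0_r. reflexivity.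
    - eapply is_derive_ext; [|exact H2]. intros t. change (Im (f (x + t * 1, q + t * 0)) = Im (f (x + t, q))).
      rewrite Rmult_1_r, Rmult_0_r, Rplus_0_r. reflexivity. }
  assert (E : D1 f = g).
  { apply functional_extensionality. intros [x q]. change (D1 f (x, q)) with (Derive (fun x => Re (f (x, q))) x, Derive (fun x => Im (f (x, q))) x).
    rewrite (surjective_pairing (g (x, q))). f_equal; apply is_derive_unique, H. }
  rewrite E. split; assumption.
Qed.

Lemma smooth_D2 (f : R * R -> C) : smoothC f ->
  smoothC (D2 f) /\
  forall x q, is_derive (fun q => Re (f (x, q))) q (Re (D2 f (x, q))) /\
              is_derive (fun q => Im (f (x, q))) q (Im (D2 f (x, q))).
Proof.
  intros Hf. destruct (smooth_directional_derivative f (0, 1) Hf) as [g [Hg Sg]].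
  assert (H : forall x q, is_derive (fun q => Re (f (x, q))) q (Re (g (x, q))) /\
              is_derive (fun q => Im (f (x, q))) q (Im (g (x, q)))).
  { intros x q. specialize (Hg (x, q)). apply is_derive_C in Hg. destruct Hg as [H1 H2].
    split; apply is_derive_translate.
    - eapply is_derive_ext; [|exact H1]. intros t. change (Re (f (x + t * 0, q + t * 1)) = Re (f (x, q + t))).
      rewrite Rmult_1_r, Rmult_0_r, Rplus_0_r. reflexivity.
    - eapply is_derive_ext; [|exact H2]. intros t. change (Im (f (x + t * 0, q + t * 1)) = Im (f (x, q + t))).
      rewrite Rmult_1_r, Rmult_0_r, Rplus_0_r. reflexivity. }
  assert (E : D2 f = g).
  { apply functional_extensionality. intros [x q]. change (D2 f (x, q)) with (Derive (fun q => Re (f (x, q))) q, Derive (fun q => Im (f (x, q))) q).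
    rewrite (surjective_pairing (g (x, q))). f_equal; apply is_derive_unique, H. }
  rewrite E. split; assumption.
Qed.

(** * The partial Fourier transform *)

(** Only the variable [x] is integrated, so that a bound on the support in [x]
    suffices; this class is stable under [D1], [D2] and multiplication by
    [i x], with the same [M]. *)
Definition compact_in_x (M : R) (f : R * R -> C) :=
  smoothC f /\ forall x q, M < Rabs x -> f (x, q) = RtoC 0.

Lemma compact_in_x_affine (M : R) (c0 c1 c2 : C) (f : R * R -> C) :
  compact_in_x M f -> compact_in_x M (fun m => affine c0 c1 c2 m * f m)%C.
Proof.
  intros [Hf Hs]. split.
  - apply smooth_span, span_mult, span_base, Hf.
  - intros x q H. rewrite (Hs x q H). ring.
Qed.

Lemma compact_in_x_D2 (M : R) (f : R * R -> C) : compact_in_x M f -> compact_in_x M (D2 f).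
Proof.
  intros [Hf Hs]. split; [apply smooth_D2, Hf|]. intros x q H.
  change (D2 f (x, q)) with (Derive (fun q => Re (f (x, q))) q, Derive (fun q => Im (f (x, q))) q).
  rewrite (Derive_ext _ (fun _ => 0)), (Derive_ext (fun q => Im (f (x, q))) (fun _ => 0)).
  - rewrite Derive_const. reflexivity.
  - intros t. rewrite (Hs x t H). reflexivity.
  - intros t. rewrite (Hs x t H). reflexivity.
Qed.

Lemma compact_in_x_D1 (M : R) (f : R * R -> C) : compact_in_x M f -> compact_in_x M (D1 f).
Proof.
  intros [Hf Hs]. split; [apply smooth_D1, Hf|]. intros x q H.
  assert (Hloc : locally x (fun y => f (y, q) = RtoC 0)).
  { assert (Ho : open (fun y => M < Rabs y)).
    { apply (open_comp Rabs (fun y => M < y)); [intros y _; apply continuous_Rabs | apply open_gt]. }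
    generalize (Ho x H). apply filter_imp. intros y Hy. apply Hs, Hy. }
  change (D1 f (x, q)) with (Derive (fun x => Re (f (x, q))) x, Derive (fun x => Im (f (x, q))) x).
  rewrite (Derive_ext_loc _ (fun _ => 0)), (Derive_ext_loc (fun x => Im (f (x, q))) (fun _ => 0)).
  - rewrite Derive_const. reflexivity.
  - revert Hloc. apply filter_imp. intros y Hy. exact (f_equal Im Hy).
  - revert Hloc. apply filter_imp. intros y Hy. exact (f_equal Re Hy).
Qed.

Lemma is_RInt_C (h : R -> C) (a b : R) (l1 l2 : R) :
  is_RInt (fun x => Re (h x)) a b l1 -> is_RInt (fun x => Im (h x)) a b l2 ->
  is_RInt (V := C_R_NormedModule) h a b (l1, l2).
Proof. apply (is_RInt_fct_extend_pair (U := R_NormedModule) (V := R_NormedModule) h). Qed.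

Lemma is_RInt_gen_C (h : R -> C) (l : C) (Fa Fb : (R -> Prop) -> Prop) {FFa : Filter Fa} {FFb : Filter Fb} :
  is_RInt_gen (fun x => Re (h x)) Fa Fb (Re l) -> is_RInt_gen (fun x => Im (h x)) Fa Fb (Im l) ->
  is_RInt_gen (V := C_R_NormedModule) h Fa Fb l.
Proof.
  intros H1 H2 P [eps HP].
  specialize (H1 (ball (Re l) eps) (locally_ball _ _)).
  specialize (H2 (ball (Im l) eps) (locally_ball _ _)).
  unfold filtermapi in *.
  generalize (filter_and (F := filter_prod Fa Fb) _ _ H1 H2). apply filter_imp.
  intros ab [[l1 [Hl1 Hb1]] [l2 [Hl2 Hb2]]].
  exists (l1, l2). split; [apply is_RInt_C; assumption|].
  apply HP. split; assumption.
Qed.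

Lemma is_RInt_gen_compact (h : R -> R) (a b l : R) :
  a <= b -> is_RInt h a b l -> (forall x, x < a \/ b < x -> h x = 0) ->
  is_RInt_gen h (Rbar_locally m_infty) (Rbar_locally p_infty) l.
Proof.
  intros Hab Hl Hs P HP.
  exists (fun x => x < a) (fun x => b < x).
  - exists a. auto.
  - exists b. auto.
  - intros x y Hx Hy. exists l. split; [|apply locally_singleton, HP]. simpl.
    replace l with (plus (plus 0 l) 0) by (unfold plus; simpl; ring).
    assert (H0 : forall u v, u <= v -> (forall z, u < z < v -> h z = 0) -> is_RInt h u v 0).
    { intros u v Huv Hz. apply is_RInt_ext with (fun _ => 0).
      - intros z. rewrite Rmin_left, Rmax_right by assumption. intros H. symmetry. apply Hz, H.
      - evar_last. { apply (is_RInt_const (V := R_NormedModule)). }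
        unfold scal; simpl; unfold mult; simpl. ring. }
    apply (is_RInt_Chasles (V := R_NormedModule)) with b.
    + apply (is_RInt_Chasles (V := R_NormedModule)) with a; [|exact Hl].
      apply H0; [lra|]. intros z Hz. apply Hs. lra.
    + apply H0; [lra|]. intros z Hz. apply Hs. lra.
Qed.

Lemma CInt_eq (h : R -> C) (l : C) :
  is_RInt_gen (V := C_R_NormedModule) h (Rbar_locally m_infty) (Rbar_locally p_infty) l ->
  CInt h = l.
Proof.
  intros H. unfold CInt.
  exact (is_RInt_gen_unique (V := C_R_CompleteNormedModule) h l H).
Qed.

(** Real and imaginary parts of the integral of [exp (i p x) f (x, q)]. *)
Definition inv_re (f : R * R -> C) (a b p q : R) : R :=
  RInt (fun x => cos (p * x) * Re (f (x, q)) - sin (p * x) * Im (f (x, q))) a b.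
Definition inv_im (f : R * R -> C) (a b p q : R) : R :=
  RInt (fun x => cos (p * x) * Im (f (x, q)) + sin (p * x) * Re (f (x, q))) a b.

Lemma smooth_cont_x (f : R * R -> C) (q : R) : smoothC f ->
  (forall x, continuous (fun x => Re (f (x, q))) x) /\
  (forall x, continuous (fun x => Im (f (x, q))) x).
Proof.
  intros Hf. destruct (smooth_continuous f Hf) as [H1 H2]. split.
  - apply (cont_partial (fun m => Re (f m))), H1.
  - apply (cont_partial (fun m => Im (f m))), H2.
Qed.

(** The interval is left free: derivatives use a fixed one, integration by parts
    one whose ends are outside the support, and inversion one centred at the
    point considered. *)
Lemma Fourier_p_inv_eq (M a b : R) (f : R * R -> C) (p q : R) :
  compact_in_x M f -> a <= b -> a <= - M -> M <= b ->
  Fourier_p_inv f (p, q) = (RtoC (/ sqrt (2 * PI)) * (inv_re f a b p q, inv_im f a b p q))%C.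
Proof.
  intros [Hf Hs] Hab Ha Hb.
  apply (f_equal (Cmult (RtoC (/ sqrt (2 * PI))))), CInt_eq.
  assert (H0 : forall x, x < a \/ b < x -> f (x, q) = RtoC 0).
  { intros x Hx. apply Hs. destruct Hx as [Hx|Hx].
    - apply Rlt_le_trans with (- x); [lra|]. rewrite <- Rabs_Ropp. apply Rle_abs.
    - apply Rlt_le_trans with x; [lra|]. apply Rle_abs. }
  destruct (smooth_cont_x f q Hf) as [C1 C2].
  apply is_RInt_gen_C; try typeclasses eauto; apply is_RInt_gen_compact with a b; try exact Hab.
  - change (is_RInt (fun x => cos (p * x) * Re (f (x, q)) - sin (p * x) * Im (f (x, q))) a b
      (inv_re f a b p q)). apply is_RInt_cont. cont.
  - intros x Hx. simpl. rewrite (H0 x Hx). unfold Re; simpl. ring.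
  - change (is_RInt (fun x => cos (p * x) * Im (f (x, q)) + sin (p * x) * Re (f (x, q))) a b
      (inv_im f a b p q)). apply is_RInt_cont. cont.
  - intros x Hx. simpl. rewrite (H0 x Hx). unfold Re; simpl. ring.
Qed.

Lemma Fourier_p_inv_radius (M : R) (f : R * R -> C) (p q : R) :
  compact_in_x M f ->
  Fourier_p_inv f (p, q) =
    (RtoC (/ sqrt (2 * PI)) *
      (inv_re f (- (Rabs M)) (Rabs M) p q, inv_im f (- (Rabs M)) (Rabs M) p q))%C.
Proof.
  intros Hf. assert (H := Rabs_pos M). assert (H' := Rle_abs M).
  apply Fourier_p_inv_eq with M; try assumption; lra.
Qed.

Lemma CDerive_scal (c : R) (u v : R -> R) (t du dv : R) :
  is_derive u t du -> is_derive v t dv ->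
  CDerive (fun t => RtoC c * (u t, v t))%C t = (RtoC c * (du, dv))%C.
Proof.
  intros Hu Hv. apply injective_projections; apply is_derive_unique.
  - apply is_derive_ext with (fun t => c * u t). { intros y. unfold Re; simpl. ring. }
    evar_last. { apply is_derive_scal, Hu. } simpl. ring.
  - apply is_derive_ext with (fun t => c * v t). { intros y. unfold Im; simpl. ring. }
    evar_last. { apply is_derive_scal, Hv. } simpl. ring.
Qed.

Definition times_ix (f : R * R -> C) (m : R * R) : C := (affine 0 Ci 0 m * f m)%C.

Lemma times_ix_eq (f : R * R -> C) (x q : R) : times_ix f (x, q) = (Ci * RtoC x * f (x, q))%C.
Proof. unfold times_ix, affine; simpl. ring. Qed.

Lemma D1_Fourier_p_inv (M : R) (f : R * R -> C) :
  compact_in_x M f -> D1 (Fourier_p_inv f) = Fourier_p_inv (times_ix f).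
Proof.
  intros Hf. apply functional_extensionality. intros [p q].
  rewrite (Fourier_p_inv_radius M) by (apply compact_in_x_affine, Hf).
  set (a := - Rabs M). set (b := Rabs M).
  destruct (smooth_continuous f (proj1 Hf)) as [C1 C2].
  destruct (smooth_cont_x f q (proj1 Hf)) as [C1' C2'].
  assert (C1x : forall m : R * R, continuous (fun m => Re (f (snd m, q))) m)
    by (apply (cont_comp (fun x => Re (f (x, q))) (fun m : R * R => snd m) C1' cont_snd)).
  assert (C2x : forall m : R * R, continuous (fun m => Im (f (snd m, q))) m)
    by (apply (cont_comp (fun x => Im (f (x, q))) (fun m : R * R => snd m) C2' cont_snd)).
  unfold D1; simpl fst; simpl snd.
  replace (fun a => Fourier_p_inv f (a, q)) with
    (fun p => RtoC (/ sqrt (2 * PI)) * (inv_re f a b p q, inv_im f a b p q))%C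
    by (apply functional_extensionality; intros; symmetry; apply Fourier_p_inv_radius, Hf).
  apply CDerive_scal.
  - evar_last.
    + apply (is_derive_RInt_parameter _
        (fun p x => - x * sin (p * x) * Re (f (x, q)) - x * cos (p * x) * Im (f (x, q)))).
      * intros t x. auto_derive; [exact I | ring].
      * cont.
      * intros t. cont.
    + apply RInt_ext. intros x _. rewrite times_ix_eq. unfold Re, Im; simpl. in_R. ring.
  - evar_last.
    + apply (is_derive_RInt_parameter _
        (fun p x => - x * sin (p * x) * Im (f (x, q)) + x * cos (p * x) * Re (f (x, q)))).
      * intros t x. auto_derive; [exact I | ring].
      * cont.
      * intros t. cont.
    + apply RInt_ext. intros x _. rewrite times_ix_eq. unfold Re, Im; simpl. in_R. ring.
Qed.

Lemma cont_swap (F : R * R -> R) : (forall m, continuous F m) ->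
  forall m : R * R, continuous (fun m => F (snd m, fst m)) m.
Proof.
  intros HF m.
  apply (continuous_comp_2 (fun m : R * R => snd m) (fun m : R * R => fst m) (fun a b => F (a, b))).
  - apply cont_snd.
  - apply cont_fst.
  - apply continuous_ext with F. { intros [? ?]; reflexivity. } apply HF.
Qed.

Lemma D2_Fourier_p_inv (M : R) (f : R * R -> C) :
  compact_in_x M f -> D2 (Fourier_p_inv f) = Fourier_p_inv (D2 f).
Proof.
  intros Hf. apply functional_extensionality. intros [p q].
  assert (Hf2 := compact_in_x_D2 M f Hf).
  rewrite (Fourier_p_inv_radius M) by exact Hf2.
  set (a := - Rabs M). set (b := Rabs M).
  destruct (smooth_continuous (D2 f) (proj1 Hf2)) as [C1 C2].
  assert (C1' := cont_swap _ C1). assert (C2' := cont_swap _ C2).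
  assert (Hd := proj2 (smooth_D2 f (proj1 Hf))).
  unfold D2 at 1; simpl fst; simpl snd.
  replace (fun b => Fourier_p_inv f (p, b)) with
    (fun q => RtoC (/ sqrt (2 * PI)) * (inv_re f a b p q, inv_im f a b p q))%C
    by (apply functional_extensionality; intros; symmetry; apply Fourier_p_inv_radius, Hf).
  apply CDerive_scal.
  - apply (is_derive_RInt_parameter
      (fun q x => cos (p * x) * Re (f (x, q)) - sin (p * x) * Im (f (x, q)))
      (fun q x => cos (p * x) * Re (D2 f (x, q)) - sin (p * x) * Im (D2 f (x, q)))).
    + intros t x. destruct (Hd x t) as [H1 H2].
      apply (is_derive_minus (V := R_NormedModule)); apply is_derive_scal; assumption.
    + cont.
    + intros t. destruct (smooth_cont_x f t (proj1 Hf)) as [K1 K2]. cont.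
  - apply (is_derive_RInt_parameter
      (fun q x => cos (p * x) * Im (f (x, q)) + sin (p * x) * Re (f (x, q)))
      (fun q x => cos (p * x) * Im (D2 f (x, q)) + sin (p * x) * Re (D2 f (x, q)))).
    + intros t x. destruct (Hd x t) as [H1 H2].
      apply (is_derive_plus (V := R_NormedModule)); apply is_derive_scal; assumption.
    + cont.
    + intros t. destruct (smooth_cont_x f t (proj1 Hf)) as [K1 K2]. cont.
Qed.

Lemma is_derive_cos_mult (p : R) (u : R -> R) (x du : R) :
  is_derive u x du ->
  is_derive (fun x => cos (p * x) * u x) x (- p * sin (p * x) * u x + cos (p * x) * du).
Proof.
  intros H. apply (is_derive_mult (K := R_AbsRing) (fun x => cos (p * x)) u); [| exact H | exact Rmult_comm].
  auto_derive; [exact I | ring].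
Qed.

Lemma is_derive_sin_mult (p : R) (u : R -> R) (x du : R) :
  is_derive u x du ->
  is_derive (fun x => sin (p * x) * u x) x (p * cos (p * x) * u x + sin (p * x) * du).
Proof.
  intros H. apply (is_derive_mult (K := R_AbsRing) (fun x => sin (p * x)) u); [| exact H | exact Rmult_comm].
  auto_derive; [exact I | ring].
Qed.

(** Integration by parts in [x], without boundary terms. *)
Lemma mult_p_Fourier_p_inv (M : R) (f : R * R -> C) (p q : R) :
  compact_in_x M f ->
  (RtoC p * Fourier_p_inv f (p, q) = Ci * Fourier_p_inv (D1 f) (p, q))%C.
Proof.
  intros Hf. assert (Hf1 := compact_in_x_D1 M f Hf).
  assert (HM : M <= Rabs M) by apply Rle_abs. assert (HM0 := Rabs_pos M).
  set (b := Rabs M + 1). set (a := - b).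
  rewrite (Fourier_p_inv_eq M a b f), (Fourier_p_inv_eq M a b (D1 f)) by (try assumption; unfold a, b; lra).
  assert (Ha : f (a, q) = RtoC 0).
  { apply (proj2 Hf). unfold a. rewrite Rabs_Ropp, Rabs_pos_eq; unfold b; lra. }
  assert (Hb : f (b, q) = RtoC 0).
  { apply (proj2 Hf). rewrite Rabs_pos_eq; unfold b; lra. }
  destruct (smooth_cont_x f q (proj1 Hf)) as [C1 C2].
  destruct (smooth_cont_x (D1 f) q (proj1 Hf1)) as [K1 K2].
  assert (Hd := proj2 (smooth_D1 f (proj1 Hf))).
  assert (Hre : inv_re (D1 f) a b p q = p * inv_im f a b p q).
  { assert (E : RInt (fun x => (cos (p * x) * Re (D1 f (x, q)) - sin (p * x) * Im (D1 f (x, q)))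
        + (- p) * (cos (p * x) * Im (f (x, q)) + sin (p * x) * Re (f (x, q)))) a b = 0).
    { rewrite (FTC (fun x => cos (p * x) * Re (f (x, q)) - sin (p * x) * Im (f (x, q)))).
      - rewrite Ha, Hb. unfold Re, Im; simpl. in_R. ring.
      - intros x. destruct (Hd x q) as [H1 H2]. evar_last.
        { apply (is_derive_minus (V := R_NormedModule)).
          - exact (is_derive_cos_mult p _ x _ H1).
          - exact (is_derive_sin_mult p _ x _ H2). }
        unfold minus, plus, opp; simpl. ring.
      - cont. }
    rewrite RInt_add in E by cont. rewrite RInt_mult_const in E by cont. unfold inv_re, inv_im.
    in_R. lra. }
  assert (Him : inv_im (D1 f) a b p q = - p * inv_re f a b p q).
  { assert (E : RInt (fun x => (cos (p * x) * Im (D1 f (x, q)) + sin (p * x) * Re (D1 f (x, q)))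
        + p * (cos (p * x) * Re (f (x, q)) - sin (p * x) * Im (f (x, q)))) a b = 0).
    { rewrite (FTC (fun x => cos (p * x) * Im (f (x, q)) + sin (p * x) * Re (f (x, q)))).
      - rewrite Ha, Hb. unfold Re, Im; simpl. in_R. ring.
      - intros x. destruct (Hd x q) as [H1 H2]. evar_last.
        { apply (is_derive_plus (V := R_NormedModule)).
          - exact (is_derive_cos_mult p _ x _ H2).
          - exact (is_derive_sin_mult p _ x _ H1). }
        unfold minus, plus, opp; simpl. ring.
      - cont. }
    rewrite RInt_add in E by cont. rewrite RInt_mult_const in E by cont. unfold inv_re, inv_im.
    in_R. lra. }
  rewrite Hre, Him. unfold Cmult, Ci, RtoC; simpl. f_equal; ring.
Qed.

Lemma RInt_shift (g : R -> R) (x L : R) : (forall y, continuous g y) ->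
  RInt g (x - L) (x + L) = RInt (fun z => g (x + z)) (- L) L.
Proof.
  intros Hg.
  assert (H := RInt_comp_lin (V := R_CompleteNormedModule) g 1 x (- L) L).
  replace (1 * - L + x) with (x - L) in H by ring. replace (1 * L + x) with (x + L) in H by ring.
  rewrite <- H by (apply ex_RInt_cont, Hg).
  apply RInt_ext. intros z _. unfold scal; simpl; unfold mult; simpl.
  rewrite Rmult_1_l. replace (1 * z + x) with (x + z) by ring. reflexivity.
Qed.

(** The factor [exp (- i p x)] moves the origin of the integration variable
    to [x], after which inversion at 0 applies. *)
Lemma rotated_inverse (M : R) (f : R * R -> C) (p q x L : R) :
  compact_in_x M f -> L = Rabs M + Rabs x + 1 ->
  (Cis (- (p * x)) * Fourier_p_inv f (p, q))%C =
  (RtoC (/ sqrt (2 * PI)) *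
    (RInt (fun z => Re (f ((x + z)%R, q)) * cos (p * z)) (- L) L
       - RInt (fun z => Im (f ((x + z)%R, q)) * sin (p * z)) (- L) L,
     RInt (fun z => Im (f ((x + z)%R, q)) * cos (p * z)) (- L) L
       + RInt (fun z => Re (f ((x + z)%R, q)) * sin (p * z)) (- L) L)%R)%C.
Proof.
  intros Hf HL.
  assert (H1 := Rle_abs M). assert (H2 := Rle_abs x).
  assert (H2' := Rle_abs (- x)). rewrite Rabs_Ropp in H2'. assert (H1' := Rabs_pos M).
  rewrite (Fourier_p_inv_eq M (x - L) (x + L) f p q Hf) by lra.
  destruct (smooth_cont_x f q (proj1 Hf)) as [C1 C2].
  assert (C1s : forall z, continuous (fun z => Re (f (x + z, q))) z).
  { apply (cont_comp (fun y => Re (f (y, q))) (fun z => x + z) C1). cont. }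
  assert (C2s : forall z, continuous (fun z => Im (f (x + z, q))) z).
  { apply (cont_comp (fun y => Im (f (y, q))) (fun z => x + z) C2). cont. }
  unfold inv_re, inv_im.
  rewrite !RInt_shift by cont.
  set (Rc := RInt (fun z => Re (f (x + z, q)) * cos (p * z)) (- L) L).
  set (Rs := RInt (fun z => Re (f (x + z, q)) * sin (p * z)) (- L) L).
  set (Ic := RInt (fun z => Im (f (x + z, q)) * cos (p * z)) (- L) L).
  set (Is := RInt (fun z => Im (f (x + z, q)) * sin (p * z)) (- L) L).
  assert (E1 : RInt (fun z => cos (p * (x + z)) * Re (f (x + z, q))
                 - sin (p * (x + z)) * Im (f (x + z, q))) (- L) L
    = cos (p * x) * (Rc - Is) + - sin (p * x) * (Rs + Ic)).
  { rewrite (RInt_ext _ (fun z => (cos (p * x) * (Re (f (x + z, q)) * cos (p * z))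
        + - cos (p * x) * (Im (f (x + z, q)) * sin (p * z)))
        + (- sin (p * x) * (Re (f (x + z, q)) * sin (p * z))
        + - sin (p * x) * (Im (f (x + z, q)) * cos (p * z))))).
    - rewrite RInt_add by cont.
      rewrite (RInt_add (fun z => cos (p * x) * (Re (f (x + z, q)) * cos (p * z)))) by cont.
      rewrite (RInt_add (fun z => - sin (p * x) * (Re (f (x + z, q)) * sin (p * z)))) by cont.
      rewrite !RInt_mult_const by cont. fold Rc Rs Ic Is. in_R. ring.
    - intros z _. rewrite Rmult_plus_distr_l, cos_plus, sin_plus. in_R. ring. }
  assert (E2 : RInt (fun z => cos (p * (x + z)) * Im (f (x + z, q))
                 + sin (p * (x + z)) * Re (f (x + z, q))) (- L) L
    = cos (p * x) * (Ic + Rs) + sin (p * x) * (Rc - Is)).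
  { rewrite (RInt_ext _ (fun z => (cos (p * x) * (Im (f (x + z, q)) * cos (p * z))
        + - sin (p * x) * (Im (f (x + z, q)) * sin (p * z)))
        + (cos (p * x) * (Re (f (x + z, q)) * sin (p * z))
        + sin (p * x) * (Re (f (x + z, q)) * cos (p * z))))).
    - rewrite RInt_add by cont.
      rewrite (RInt_add (fun z => cos (p * x) * (Im (f (x + z, q)) * cos (p * z)))) by cont.
      rewrite (RInt_add (fun z => cos (p * x) * (Re (f (x + z, q)) * sin (p * z)))) by cont.
      rewrite !RInt_mult_const by cont. fold Rc Rs Ic Is. in_R. ring.
    - intros z _. rewrite Rmult_plus_distr_l, cos_plus, sin_plus. in_R. ring. }
  rewrite E1, E2.
  assert (Hcs := sin2_cos2 (p * x)). unfold Rsqr in Hcs.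
  unfold Cis, Cmult, RtoC; simpl. rewrite cos_neg, sin_neg.
  set (co := cos (p * x)) in *. set (si := sin (p * x)) in *. set (k := / sqrt (2 * PI)).
  f_equal.
  - transitivity (k * (Rc - Is) * (si * si + co * co)); [ring | rewrite Hcs; ring].
  - transitivity (k * (Ic + Rs) * (si * si + co * co)); [ring | rewrite Hcs; ring].
Qed.

(** Unlike [Fourier_p], which is defined for every function, this asserts the
    convergence of the integral and is therefore compatible with linear
    combinations. *)
Definition has_Fourier (g : R -> C) (x : R) (l : C) : Prop :=
  is_RInt_gen (fun p => Re (Cis (- (p * x)) * g p)%C) (Rbar_locally m_infty) (Rbar_locally p_infty)
    (sqrt (2 * PI) * Re l) /\
  is_RInt_gen (fun p => Im (Cis (- (p * x)) * g p)%C) (Rbar_locally m_infty) (Rbar_locally p_infty)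
    (sqrt (2 * PI) * Im l).

Lemma sqrt_2PI_pos : 0 < sqrt (2 * PI).
Proof. apply sqrt_lt_R0. assert (H := PI_RGT_0). lra. Qed.

Lemma Fourier_p_of_has_Fourier (F : R * R -> C) (x q : R) (l : C) :
  has_Fourier (fun p => F (p, q)) x l -> Fourier_p F (x, q) = l.
Proof.
  intros [H1 H2]. assert (Hs := sqrt_2PI_pos).
  unfold Fourier_p. simpl fst; simpl snd.
  rewrite (CInt_eq _ (RtoC (sqrt (2 * PI)) * l)%C).
  - rewrite Cmult_assoc, <- RtoC_mult, Rinv_l by lra. ring.
  - apply is_RInt_gen_C; try typeclasses eauto.
    + evar_last; [exact H1|]. unfold Re, Cmult; simpl. ring.
    + evar_last; [exact H2|]. unfold Im, Cmult; simpl. ring.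
Qed.

Lemma is_RInt_gen_lincomb (u v : R -> R) (a b lu lv : R) :
  is_RInt_gen u (Rbar_locally m_infty) (Rbar_locally p_infty) lu ->
  is_RInt_gen v (Rbar_locally m_infty) (Rbar_locally p_infty) lv ->
  is_RInt_gen (fun p => a * u p + b * v p) (Rbar_locally m_infty) (Rbar_locally p_infty) (a * lu + b * lv).
Proof.
  intros Hu Hv.
  apply (is_RInt_gen_plus (V := R_NormedModule) (fun p => a * u p) (fun p => b * v p)).
  - apply (is_RInt_gen_scal (V := R_NormedModule) u a lu Hu).
  - apply (is_RInt_gen_scal (V := R_NormedModule) v b lv Hv).
Qed.

Lemma is_RInt_gen_eq (u v : R -> R) (lu lv : R) :
  (forall p, u p = v p) -> lu = lv ->
  is_RInt_gen u (Rbar_locally m_infty) (Rbar_locally p_infty) lu ->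
  is_RInt_gen v (Rbar_locally m_infty) (Rbar_locally p_infty) lv.
Proof.
  intros H <-. apply is_RInt_gen_ext. apply filter_forall. intros ab x _. apply H.
Qed.

Lemma has_Fourier_plus (g1 g2 : R -> C) (x : R) (l1 l2 : C) :
  has_Fourier g1 x l1 -> has_Fourier g2 x l2 ->
  has_Fourier (fun p => g1 p + g2 p)%C x (l1 + l2)%C.
Proof.
  intros [H1 H2] [K1 K2]. split.
  - eapply is_RInt_gen_eq; [| |exact (is_RInt_gen_lincomb _ _ 1 1 _ _ H1 K1)];
      intros; unfold Re; simpl; ring.
  - eapply is_RInt_gen_eq; [| |exact (is_RInt_gen_lincomb _ _ 1 1 _ _ H2 K2)];
      intros; unfold Im; simpl; ring.
Qed.

Lemma has_Fourier_mult (z : C) (g : R -> C) (x : R) (l : C) :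
  has_Fourier g x l -> has_Fourier (fun p => z * g p)%C x (z * l)%C.
Proof.
  intros [H1 H2]. split.
  - eapply is_RInt_gen_eq; [| |exact (is_RInt_gen_lincomb _ _ (Re z) (- Im z) _ _ H1 H2)];
      intros; unfold Re, Im; simpl; ring.
  - eapply is_RInt_gen_eq; [| |exact (is_RInt_gen_lincomb _ _ (Re z) (Im z) _ _ H2 H1)];
      intros; unfold Re, Im; simpl; ring.
Qed.

Lemma has_Fourier_inverse (M : R) (f : R * R -> C) (x q : R) :
  compact_in_x M f -> has_Fourier (fun p => Fourier_p_inv f (p, q)) x (f (x, q)).
Proof.
  intros Hf.
  set (L := Rabs M + Rabs x + 1).
  assert (HL : 0 < L) by (unfold L; pose proof (Rabs_pos M); pose proof (Rabs_pos x); lra).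
  assert (Hf1 := compact_in_x_D1 M f Hf). assert (Hf2 := compact_in_x_D1 M _ Hf1).
  assert (Hf3 := compact_in_x_D1 M _ Hf2).
  assert (Hsh : forall (h h1 : R -> R), (forall y, is_derive h y (h1 y)) ->
    forall z, is_derive (fun z => h (x + z)) z (h1 (x + z))).
  { intros h h1 H z. evar_last.
    - apply (is_derive_comp h (fun z => x + z)); [apply H | auto_derive; [exact I | reflexivity]].
    - unfold scal; simpl; unfold mult; simpl. ring. }
  assert (D0 := proj2 (smooth_D1 f (proj1 Hf))).
  assert (D1' := proj2 (smooth_D1 _ (proj1 Hf1))).
  assert (D2' := proj2 (smooth_D1 _ (proj1 Hf2))).
  destruct (smooth_cont_x _ q (proj1 Hf3)) as [K1 K2].
  assert (KR := cont_comp _ (fun z => x + z) K1 ltac:(cont)).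
  assert (KI := cont_comp _ (fun z => x + z) K2 ltac:(cont)).
  assert (Rc := fourier_inversion_cos _ _ _ _ L
    (Hsh _ _ (fun y => proj1 (D0 y q))) (Hsh _ _ (fun y => proj1 (D1' y q)))
    (Hsh _ _ (fun y => proj1 (D2' y q))) KR HL).
  assert (Rs := fourier_inversion_sin _ _ _ _ L
    (Hsh _ _ (fun y => proj1 (D0 y q))) (Hsh _ _ (fun y => proj1 (D1' y q)))
    (Hsh _ _ (fun y => proj1 (D2' y q))) KR HL).
  assert (Ic := fourier_inversion_cos _ _ _ _ L
    (Hsh _ _ (fun y => proj2 (D0 y q))) (Hsh _ _ (fun y => proj2 (D1' y q)))
    (Hsh _ _ (fun y => proj2 (D2' y q))) KI HL).
  assert (Is := fourier_inversion_sin _ _ _ _ L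
    (Hsh _ _ (fun y => proj2 (D0 y q))) (Hsh _ _ (fun y => proj2 (D1' y q)))
    (Hsh _ _ (fun y => proj2 (D2' y q))) KI HL).
  cbv beta in Rc, Ic. rewrite Rplus_0_r in Rc, Ic.
  set (k := / sqrt (2 * PI)).
  assert (Hk : k * (2 * PI) = sqrt (2 * PI)).
  { assert (Hs := sqrt_2PI_pos). assert (HP := PI_RGT_0). unfold k.
    rewrite <- (sqrt_sqrt (2 * PI)) at 2 by lra. field. lra. }
  split.
  - eapply is_RInt_gen_eq; [| |exact (is_RInt_gen_lincomb _ _ k (- k) _ _ Rc Is)].
    + intros p. cbv beta. rewrite (rotated_inverse M f p q x L Hf eq_refl).
      unfold Re at 2, Cmult, RtoC; simpl. fold k. in_R. ring.
    + rewrite <- Hk. change (k * (2 * PI * Re (f (x, q))) + - k * 0 = k * (2 * PI) * Re (f (x, q))). ring.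
  - eapply is_RInt_gen_eq; [| |exact (is_RInt_gen_lincomb _ _ k k _ _ Ic Rs)].
    + intros p. cbv beta. rewrite (rotated_inverse M f p q x L Hf eq_refl).
      unfold Im at 2, Cmult, RtoC; simpl. fold k. in_R. ring.
    + rewrite <- Hk. change (k * (2 * PI * Im (f (x, q))) + k * 0 = k * (2 * PI) * Im (f (x, q))). ring.
Qed.

(** * The terms of the Moyal series *)

Definition symbol (A B : R -> R) (m : R * R) : C := RtoC (A (snd m) * fst m + B (snd m)).

Lemma Derive_n_Derive (A : R -> R) (n : nat) (x : R) :
  Derive_n (Derive A) n x = Derive_n A (S n) x.
Proof.
  replace (S n) with (n + 1)%nat by lia. rewrite <- Derive_n_comp. reflexivity.
Qed.

Lemma infinitely_derivable_Derive (A : R -> R) :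
  infinitely_derivable A -> infinitely_derivable (Derive A).
Proof.
  intros H [|n] x; [exact I|].
  apply ex_derive_ext with (Derive_n A (S n)).
  - intros t. symmetry. apply Derive_n_Derive.
  - exact (H (S (S n)) x).
Qed.

Lemma D1_symbol (A B : R -> R) : D1 (symbol A B) = symbol (fun _ => 0) A.
Proof.
  apply functional_extensionality. intros [p q].
  apply injective_projections; apply is_derive_unique; unfold Re, Im; simpl.
  - auto_derive; [exact I | ring].
  - apply (is_derive_const (V := R_NormedModule)).
Qed.

Lemma D2_symbol (A B : R -> R) :
  infinitely_derivable A -> infinitely_derivable B ->
  D2 (symbol A B) = symbol (Derive A) (Derive B).
Proof.
  intros HA HB. apply functional_extensionality. intros [p q].
  apply injective_projections; apply is_derive_unique; unfold Re, Im; simpl.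
  - apply is_derive_ext with (fun q => p * A q + B q). { intros t. in_R. ring. }
    evar_last.
    + apply (is_derive_plus (V := R_NormedModule) (fun q => p * A q) B).
      * apply is_derive_scal, (is_derive_Derive_n A 0 q HA).
      * apply (is_derive_Derive_n B 0 q HB).
    + change (p * Derive A q + Derive B q = Derive A q * p + Derive B q). ring.
  - apply (is_derive_const (V := R_NormedModule)).
Qed.

Lemma D1_times_ix (f : R * R -> C) (m : R * R) : smoothC f ->
  D1 (times_ix f) m = (Ci * f m + times_ix (D1 f) m)%C.
Proof.
  intros Hf. destruct m as [x q]. destruct (proj2 (smooth_D1 f Hf) x q) as [H1 H2].
  rewrite times_ix_eq.
  apply injective_projections; apply is_derive_unique.
  - apply is_derive_ext with (fun y => - (y * Im (f (y, q)))).
    { intros y. cbv beta. simpl fst. simpl snd. rewrite times_ix_eq. unfold Re, Im; simpl. ring. }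
    evar_last.
    + apply (is_derive_opp (V := R_NormedModule)).
      apply (is_derive_mult (K := R_AbsRing) (fun y => y) _ _ _ _ (is_derive_id _) H2 Rmult_comm).
    + unfold opp, plus, mult, one, Re, Im; simpl. ring.
  - apply is_derive_ext with (fun y => y * Re (f (y, q))).
    { intros y. cbv beta. simpl fst. simpl snd. rewrite times_ix_eq. unfold Re, Im; simpl. ring. }
    evar_last.
    + apply (is_derive_mult (K := R_AbsRing) (fun y => y) _ _ _ _ (is_derive_id _) H1 Rmult_comm).
    + unfold opp, plus, mult, one, Re, Im; simpl. ring.
Qed.

Lemma D2_times_ix (f : R * R -> C) : smoothC f -> D2 (times_ix f) = times_ix (D2 f).
Proof.
  intros Hf. apply functional_extensionality. intros [x q].
  destruct (proj2 (smooth_D2 f Hf) x q) as [H1 H2].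
  rewrite times_ix_eq.
  apply injective_projections; apply is_derive_unique.
  - apply is_derive_ext with (fun y => (- x) * Im (f (x, y))).
    { intros y. cbv beta. simpl fst. simpl snd. rewrite times_ix_eq. unfold Re, Im; simpl. ring. }
    evar_last. { apply is_derive_scal, H2. } unfold Re, Im; simpl. ring.
  - apply is_derive_ext with (fun y => x * Re (f (x, y))).
    { intros y. cbv beta. simpl fst. simpl snd. rewrite times_ix_eq. unfold Re, Im; simpl. ring. }
    evar_last. { apply is_derive_scal, H1. } unfold Re, Im; simpl. ring.
Qed.

Lemma compact_in_x_iter (M : R) (r : nat) (f : R * R -> C) :
  compact_in_x M f -> compact_in_x M (Nat.iter r times_ix f).
Proof. intros Hf. induction r as [|r IH]; [exact Hf | apply compact_in_x_affine, IH]. Qed.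

Lemma iter_times_ix (r : nat) (f : R * R -> C) (x q : R) :
  Nat.iter r times_ix f (x, q) = (Cpow (Ci * RtoC x) r * f (x, q))%C.
Proof.
  induction r as [|r IH]; simpl Nat.iter.
  - simpl. ring.
  - rewrite times_ix_eq, IH. simpl. ring.
Qed.

Lemma D1_iter_times_ix (M : R) (r : nat) (f : R * R -> C) (x q : R) :
  compact_in_x M f ->
  D1 (Nat.iter r times_ix f) (x, q)
  = (Cpow (Ci * RtoC x) r * D1 f (x, q)
     + RtoC (INR r) * Ci * Cpow (Ci * RtoC x) (pred r) * f (x, q))%C.
Proof.
  intros Hf. induction r as [|r IH].
  - simpl. ring.
  - simpl Nat.iter. rewrite D1_times_ix by (apply (compact_in_x_iter M), Hf).
    rewrite times_ix_eq, IH, iter_times_ix, S_INR, RtoC_plus. simpl pred.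
    destruct r as [|r]; simpl; ring.
Qed.

(** Each step of the recursion either differentiates the symbol in [q] or drops
    its degree in [p] from one to zero; the factor [r] counts the steps at which
    the drop may occur.  At [r = 0], where [pred r] is a default value, it
    cancels the second summand. *)
Lemma P_symbol (M : R) (r : nat) : forall (A B : R -> R) (f : R * R -> C) (p q : R),
  infinitely_derivable A -> infinitely_derivable B -> compact_in_x M f ->
  P r (symbol A B) (Fourier_p_inv f) (p, q)
  = (RtoC ((-1) ^ r) * RtoC (Derive_n A r q * p + Derive_n B r q)
       * Fourier_p_inv (Nat.iter r times_ix f) (p, q)
     + RtoC (INR r * (-1) ^ (pred r) * Derive_n A (pred r) q)
       * Fourier_p_inv (Nat.iter (pred r) times_ix (D2 f)) (p, q))%C.
Proof.
  induction r as [|r IH]; intros A B f p q HA HB Hf.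
  - simpl. unfold symbol; simpl. rewrite Rmult_0_l. simpl.
    replace (RtoC (0 * A q)) with (RtoC 0) by (f_equal; ring). ring.
  (* One application of the induction hypothesis is to the symbol [A q], of
       degree zero in [p], the other to the symbol differentiated in [q]. *)
  - assert (H0 : infinitely_derivable (fun _ => 0)).
    { intros n x. apply ex_derive_n_const. }
    simpl P. unfold sum_index; simpl partial; simpl Lambda.
    rewrite D1_symbol, (D2_symbol A B HA HB), (D1_Fourier_p_inv M f Hf), (D2_Fourier_p_inv M f Hf).
    rewrite (IH (fun _ => 0) A (D2 f) p q H0 HA (compact_in_x_D2 M f Hf)).
    rewrite (IH (Derive A) (Derive B) (times_ix f) p q (infinitely_derivable_Derive A HA)
      (infinitely_derivable_Derive B HB) (compact_in_x_affine M 0 Ci 0 f Hf)).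
    rewrite D2_times_ix by apply Hf.
    rewrite !Derive_n_Derive. rewrite !Nat.iter_swap.
    assert (Hc : forall n, Derive_n (fun _ => 0) n q = 0).
    { intros [|n]; [reflexivity | apply Derive_n_const]. }
    rewrite !Hc.
    change (times_ix (Nat.iter r times_ix f)) with (Nat.iter (S r) times_ix f).
    change (times_ix (Nat.iter (pred r) times_ix (D2 f))) with (Nat.iter (S (pred r)) times_ix (D2 f)).
    set (W := Fourier_p_inv (Nat.iter (S r) times_ix f) (p, q)).
    simpl pred.
    destruct r as [|r].
    + simpl Nat.iter. change (INR 0) with 0. change (INR 1) with 1. simpl pow.
      set (W2 := Fourier_p_inv (D2 f) (p, q)).
      rewrite ?RtoC_mult, ?RtoC_plus, ?RtoC_mult. simpl Derive_n. ring.
    + simpl pred.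
      set (W2 := Fourier_p_inv (Nat.iter (S r) times_ix (D2 f)) (p, q)).
      rewrite (S_INR (S r)). rewrite <- !tech_pow_Rmult.
      rewrite ?RtoC_mult, ?RtoC_plus, ?RtoC_mult. ring.
Qed.

Lemma Ci_inv_2Ci : (Ci * / (2 * Ci) = RtoC (/ 2))%C.
Proof.
  assert (HC : Ci <> RtoC 0). { intros H. apply (f_equal snd) in H. simpl in H. lra. }
  rewrite RtoC_inv by lra. field. exact HC.
Qed.

(** The factors [1/(2i)] of the product, [i x] of the transform and the signs
    of [Lambda] combine into the Taylor increment [- x / 2]. *)
Lemma moyal_power (x y : R) (n : nat) : y = - x / 2 ->
  (Cpow (/ (2 * Ci)) n * Cpow (Ci * RtoC x) n * RtoC ((-1) ^ n) = RtoC (y ^ n))%C.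
Proof.
  intros ->. induction n as [|n IH]; simpl.
  - ring.
  - rewrite !RtoC_mult, <- IH.
    transitivity (Ci * / (2 * Ci) * RtoC x * RtoC (-1)
      * (Cpow (/ (2 * Ci)) n * Cpow (Ci * RtoC x) n * RtoC ((-1) ^ n)))%C; [ring|].
    rewrite Ci_inv_2Ci. rewrite <- !RtoC_mult.
    replace (/ 2 * x * -1) with (- x / 2) by field. ring.
Qed.

Lemma ell_hat_term_symbol (M : R) (A B : R -> R) (f : R * R -> C) (x q y : R) (r : nat) :
  infinitely_derivable A -> infinitely_derivable B -> compact_in_x M f -> y = - x / 2 ->
  ell_hat_term (symbol A B) f (x, q) r
  = (RtoC (Derive_n A r q / INR (fact r) * y ^ r) * - D1 f (x, q)
     + RtoC (Derive_n B r q / INR (fact r) * y ^ r) * (Ci * f (x, q))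
     + RtoC (INR r / INR (fact r) * Derive_n A r q * y ^ pred r) * (RtoC (/ 2) * f (x, q))
     + RtoC (INR r / INR (fact r) * Derive_n A (pred r) q * y ^ pred r)
       * (RtoC (/ 2) * D2 f (x, q)))%C.
Proof.
  intros HA HB Hf Hy.
  set (k := (Ci * (RtoC (/ INR (fact r)) * Cpow (/ (2 * Ci)) r))%C).
  set (g := Nat.iter r times_ix f). set (g2 := Nat.iter (pred r) times_ix (D2 f)).
  assert (Hg : compact_in_x M g) by (apply compact_in_x_iter, Hf).
  assert (Hg2 : compact_in_x M g2) by (apply compact_in_x_iter, compact_in_x_D2, Hf).
  unfold ell_hat_term.
  erewrite Fourier_p_of_has_Fourier.
  2:{ eassert (E : (fun p => (Ci * star_term r (symbol A B) (Fourier_p_inv f) (p, q))%C) = _).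
      { apply functional_extensionality. intros p. unfold star_term.
        rewrite (P_symbol M r A B f p q HA HB Hf). fold g g2.
        instantiate (1 := fun p =>
          ((k * RtoC ((-1) ^ r) * RtoC (Derive_n A r q) * Ci) * Fourier_p_inv (D1 g) (p, q)
           + (k * RtoC ((-1) ^ r) * RtoC (Derive_n B r q)) * Fourier_p_inv g (p, q)
           + (k * RtoC (INR r * (-1) ^ pred r * Derive_n A (pred r) q)) * Fourier_p_inv g2 (p, q))%C).
        cbv beta.
        transitivity (k * RtoC ((-1) ^ r) * RtoC (Derive_n A r q) * (RtoC p * Fourier_p_inv g (p, q))
           + (k * RtoC ((-1) ^ r) * RtoC (Derive_n B r q)) * Fourier_p_inv g (p, q)
           + (k * RtoC (INR r * (-1) ^ pred r * Derive_n A (pred r) q)) * Fourier_p_inv g2 (p, q))%C.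
        - unfold k. rewrite RtoC_plus, (RtoC_mult (Derive_n A r q) p). ring.
        - rewrite (mult_p_Fourier_p_inv M g p q Hg). ring. }
      rewrite E.
      apply has_Fourier_plus; [apply has_Fourier_plus|]; apply has_Fourier_mult, (has_Fourier_inverse M);
        [apply compact_in_x_D1, Hg | exact Hg | exact Hg2]. }
  unfold g, g2. rewrite (D1_iter_times_ix M r f x q Hf), !iter_times_ix. unfold k.
  destruct r as [|n].
  - simpl. rewrite !Rmult_1_r, Rinv_1. change (INR 0) with 0. unfold Rdiv.
    rewrite !Rmult_0_l, !Rinv_1, !Rmult_1_r.
    assert (HCi : (Ci * Ci = RtoC (-1))%C) by (apply injective_projections; simpl; ring).
    transitivity ((Ci * Ci) * (RtoC (A q) * D1 f (x, q)) + RtoC (B q) * (Ci * f (x, q)))%C; [ring|].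
    rewrite HCi. ring.
  - assert (HP := moyal_power x y n Hy). simpl pred.
    set (a := Cpow (/ (2 * Ci)) n) in *. set (b := Cpow (Ci * RtoC x) n) in *.
    set (c := RtoC ((-1) ^ n)) in *.
    change (Cpow (/ (2 * Ci)) (S n)) with (/ (2 * Ci) * a)%C.
    change (Cpow (Ci * RtoC x) (S n)) with (Ci * RtoC x * b)%C.
    rewrite <- !tech_pow_Rmult.
    unfold Rdiv. rewrite ?RtoC_mult. fold c.
    set (rf := RtoC (/ INR (fact (S n)))). set (N := RtoC (INR (S n))).
    rewrite <- HP. rewrite Hy. unfold Rdiv.
    replace (RtoC (- x * / 2)) with (RtoC (-1) * RtoC x * RtoC (/ 2))%C
      by (rewrite <- !RtoC_mult; f_equal; ring).
    rewrite <- Ci_inv_2Ci. set (kap := (/ (2 * Ci))%C).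
    assert (HCi : (Ci * Ci = RtoC (-1))%C) by (apply injective_projections; simpl; ring).
    transitivity ((Ci * Ci) * (RtoC (Derive_n A (S n) q) * rf * (RtoC (-1) * RtoC x * (Ci * kap) * (a * b * c)) * D1 f (x, q))
      + RtoC (Derive_n B (S n) q) * rf * (RtoC (-1) * RtoC x * (Ci * kap) * (a * b * c)) * (Ci * f (x, q))
      + RtoC (-1) * (Ci * Ci) * (N * rf * RtoC (Derive_n A (S n) q) * (a * b * c) * (Ci * kap * f (x, q)))
      + N * rf * RtoC (Derive_n A n q) * (a * b * c) * (Ci * kap * D2 f (x, q)))%C; [ring|].
    rewrite HCi. ring.
Qed.

(** * Summation of the series *)

Lemma is_series_linear {U W : NormedModule R_AbsRing} (L : U -> W) (a : nat -> U) (l : U) :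
  is_linear L -> is_series a l -> is_series (fun n => L (a n)) (L l).
Proof.
  intros HL Ha. unfold is_series.
  apply filterlim_ext with (fun n => L (sum_n a n)).
  - intros n. induction n as [|n IH].
    + rewrite !sum_O. reflexivity.
    + rewrite !sum_Sn, (linear_plus L HL), IH. reflexivity.
  - eapply filterlim_comp; [exact Ha | apply (linear_cont L l HL)].
Qed.

Lemma is_series_RtoC_mult (a : nat -> R) (l : R) (z : C) :
  is_series a l -> is_series (V := C_R_NormedModule) (fun n => RtoC (a n) * z)%C (RtoC l * z)%C.
Proof.
  intros Ha.
  assert (H := is_series_linear (W := C_R_NormedModule) (fun t : R_NormedModule => scal t z) a l
    (is_linear_scal_l (V := C_R_NormedModule) z) Ha).
  assert (E : forall t : R, scal (V := C_R_NormedModule) t z = (RtoC t * z)%C).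
  { intros t. apply injective_projections; simpl; unfold scal; simpl; unfold mult; simpl; ring. }
  cbv beta in H. rewrite <- E. eapply is_series_ext; [|exact H]. intros n. apply E.
Qed.

Lemma is_series_Re (a : nat -> C) (l : C) :
  is_series (V := C_R_NormedModule) a l -> is_series (fun n => Re (a n)) (Re l).
Proof. apply (is_series_linear (U := C_R_NormedModule) (W := R_NormedModule) fst). apply is_linear_fst. Qed.

Lemma is_series_Im (a : nat -> C) (l : C) :
  is_series (V := C_R_NormedModule) a l -> is_series (fun n => Im (a n)) (Im l).
Proof. apply (is_series_linear (U := C_R_NormedModule) (W := R_NormedModule) snd). apply is_linear_snd. Qed.

Lemma CSeries_unique (a : nat -> C) (l : C) :
  is_series (V := C_R_NormedModule) a l -> CSeries a = l.
Proof.
  intros H. apply injective_projections; apply is_series_unique.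
  - apply is_series_Re, H.
  - apply is_series_Im, H.
Qed.

Lemma derivative_weight (n : nat) : INR (S n) / INR (fact (S n)) = / INR (fact n).
Proof.
  change (fact (S n)) with (S n * fact n)%nat. rewrite mult_INR. field.
  split; [apply INR_fact_neq_0 | apply not_0_INR; lia].
Qed.

Lemma is_series_shift (a b : nat -> R) (l : R) :
  is_series a l -> b 0%nat = 0 -> (forall n, b (S n) = a n) -> is_series b l.
Proof.
  intros Ha H0 HS. apply is_series_decr_1.
  apply is_series_ext with a; [intros n; symmetry; apply HS|].
  evar_last; [exact Ha|]. rewrite H0. change (l = l + - 0). ring.
Qed.

Lemma is_series_ell_hat (M : R) (A B : R -> R) (f : R * R -> C) (x q : R) :
  infinitely_derivable A -> infinitely_derivable B ->
  (forall c z, expands A c z) -> (forall c z, expands B c z) ->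
  compact_in_x M f ->
  is_series (V := C_R_NormedModule) (ell_hat_term (symbol A B) f (x, q))
    (RtoC (A (q - x / 2)%R) * (RtoC (/ 2) * D2 f (x, q) - D1 f (x, q))
      + Ci * RtoC (B (q - x / 2)%R) * f (x, q)
      + RtoC (/ 2 * Derive A (q - x / 2))%R * f (x, q))%C.
Proof.
  intros HA HB EA EB Hf.
  set (z := q - x / 2). set (y := z - q).
  assert (Hy : y = - x / 2) by (unfold y, z; field).
  assert (S1 := EA q z 0%nat). assert (S2 := EB q z 0%nat). assert (S3 := EA q z 1%nat).
  fold y in S1, S2, S3.
  assert (S3' : is_series (fun r => INR r / INR (fact r) * Derive_n A r q * y ^ pred r) (Derive A z)).
  { apply (is_series_shift _ _ _ S3).
    - simpl. field.
    - intros n. rewrite derivative_weight. simpl. unfold Rdiv. ring. }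
  assert (S4 : is_series (fun r => INR r / INR (fact r) * Derive_n A (pred r) q * y ^ pred r) (A z)).
  { apply (is_series_shift _ _ _ S1).
    - simpl. field.
    - intros n. rewrite derivative_weight. simpl. unfold Rdiv. ring. }
  assert (H := is_series_plus _ _ _ _ (is_series_plus _ _ _ _ (is_series_plus _ _ _ _
    (is_series_RtoC_mult _ _ (- D1 f (x, q))%C S1)
    (is_series_RtoC_mult _ _ (Ci * f (x, q))%C S2))
    (is_series_RtoC_mult _ _ (RtoC (/ 2) * f (x, q))%C S3'))
    (is_series_RtoC_mult _ _ (RtoC (/ 2) * D2 f (x, q))%C S4)).
  evar_last.
  - eapply is_series_ext; [|exact H]. intros r. symmetry.
    apply (ell_hat_term_symbol M A B f x q y r HA HB Hf Hy).
  - change (Derive_n A 0 z) with (A z). change (Derive_n B 0 z) with (B z).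
    rewrite RtoC_mult.
    match goal with |- ?l = _ => change l with
      (RtoC (A z) * - D1 f (x, q) + RtoC (B z) * (Ci * f (x, q))
       + RtoC (Derive A z) * (RtoC (/ 2) * f (x, q)) + RtoC (A z) * (RtoC (/ 2) * D2 f (x, q)))%C end.
    in_C. ring.
Qed.

Lemma growth_of_ex_series (g : R -> R) (c B : R) :
  0 < B -> ex_series (fun k => Derive_n g k c / INR (fact k) * (/ B) ^ k) -> exists K, growth g K B c.
Proof.
  intros HB Hex.
  (* The terms of a convergent series tend to 0, hence are bounded. *)
  destruct (filterlim_bounded (V := R_NormedModule)
    (fun k => Derive_n g k c / INR (fact k) * (/ B) ^ k)) as [K HK].
  { exists 0. exact (ex_series_lim_0 _ Hex). }
  exists K. intros k. specialize (HK k). unfold norm in HK; simpl in HK. unfold abs in HK; simpl in HK.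
  assert (HBk : 0 < B ^ k) by (apply pow_lt, HB). assert (Hf := INR_fact_lt_0 k).
  replace (Derive_n g k c) with (Derive_n g k c / INR (fact k) * (/ B) ^ k * (INR (fact k) * B ^ k)).
  2:{ rewrite pow_inv. field. lra. }
  rewrite Rabs_mult, (Rabs_pos_eq (INR (fact k) * B ^ k)) by (apply Rmult_le_pos; lra).
  rewrite Rmult_assoc. apply Rmult_le_compat_r; [apply Rmult_le_pos; lra | exact HK].
Qed.

Lemma growth_of_Derive (g : R -> R) (K B c : R) :
  0 < B -> growth (Derive g) K B c -> growth g (Rabs (g c) + K / B) B c.
Proof.
  intros HB HK.
  assert (HK0 : 0 <= K).
  { specialize (HK 0%nat). simpl in HK. pose proof (Rabs_pos (Derive g c)). lra. }
  assert (HKB : 0 <= K / B) by (apply Rdiv_le_0_compat; lra).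
  assert (Hg := Rabs_pos (g c)).
  intros [|k].
  - simpl. lra.
  - rewrite <- Derive_n_Derive. eapply Rle_trans; [apply HK|].
    assert (HBk : 0 < B ^ k) by (apply pow_lt, HB).
    assert (Hf : INR (fact k) <= INR (fact (S k))) by (apply le_INR, fact_le; lia).
    assert (Hf0 := INR_fact_lt_0 k).
    simpl pow.
    replace (K * INR (fact k) * B ^ k) with (K / B * INR (fact k) * (B * B ^ k)) by (field; lra).
    apply Rmult_le_compat_r; [apply Rmult_le_pos; lra|].
    apply Rmult_le_compat; lra.
Qed.

Lemma pringsheim_of_convergence (g : R -> R) :
  infinitely_derivable g ->
  (forall c y, ex_series (fun k => Derive_n g k c / INR (fact k) * y ^ k)) ->
  forall c z, expands g c z.
Proof.
  intros Hg Hex. apply pringsheim; [exact Hg|].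
  intros B x HB. apply growth_of_ex_series; [exact HB | apply Hex].
Qed.

(** The terms of the Moyal series control [Phi] only through the Taylor series
    of [Phi']. *)
Lemma pringsheim_of_Derive_convergence (g : R -> R) :
  infinitely_derivable g ->
  (forall c y, ex_series (fun k => Derive_n (Derive g) k c / INR (fact k) * y ^ k)) ->
  forall c z, expands g c z.
Proof.
  intros Hg Hex. apply pringsheim; [exact Hg|].
  intros B x HB. destruct (growth_of_ex_series (Derive g) x B HB (Hex x (/ B))) as [K HK].
  eexists. apply (growth_of_Derive g K B x HB HK).
Qed.

Lemma smooth_infinitely_derivable (g : R -> R) :
  @smooth R_NormedModule R_NormedModule g -> infinitely_derivable g.
Proof.
  intros Hg.
  assert (Hd : forall h : R -> R, @smooth R_NormedModule R_NormedModule h ->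
    (forall x, ex_derive h x) /\ @smooth R_NormedModule R_NormedModule (Derive h)).
  { intros h Hh.
    assert (H1 : forall n, exists h1 : R -> R, (forall x, is_derive h x (h1 x)) /\
      @Cn R_NormedModule R_NormedModule n h1).
    { intros n. destruct (Hh (S n) 1) as [h1 [H1 Hn]]. exists h1. split; [|exact Hn].
      intros x. apply is_derive_translate. eapply is_derive_ext; [|exact (H1 x)].
      intros t. unfold plus, scal; simpl; unfold mult; simpl. rewrite Rmult_1_r. reflexivity. }
    split.
    - intros x. destruct (H1 0%nat) as [h1 [H _]]. eexists; apply H.
    - intros n. destruct (H1 n) as [h1 [H Hn]].
      replace (Derive h) with h1; [exact Hn|].
      apply functional_extensionality. intros x. symmetry. apply is_derive_unique, H. }
  assert (Hn : forall n, @smooth R_NormedModule R_NormedModule (Derive_n g n)).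
  { intros n. induction n as [|n IH]; [exact Hg | exact (proj2 (Hd _ IH))]. }
  intros [|n] x; [exact I | exact (proj1 (Hd _ (Hn n)) x)].
Qed.

(** * Bump functions *)

(** The family [exp (- 1 / x) / x ^ n], extended by 0, is closed under
    differentiation up to linear combinations. *)
Definition flat (n : nat) (x : R) : R :=
  if Rlt_dec 0 x then exp (- / x) / x ^ n else 0.

Lemma flat_pos (n : nat) (x : R) : 0 < x -> flat n x = exp (- / x) / x ^ n.
Proof. intros H. unfold flat. destruct (Rlt_dec 0 x); [reflexivity | contradiction]. Qed.

Lemma flat_neg (n : nat) (x : R) : x <= 0 -> flat n x = 0.
Proof. intros H. unfold flat. destruct (Rlt_dec 0 x); [lra | reflexivity]. Qed.

Lemma exp_INR_mult (k : nat) (v : R) : exp (INR k * v) = exp v ^ k.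
Proof.
  induction k as [|k IH]; [simpl; rewrite Rmult_0_l; apply exp_0|].
  rewrite S_INR, Rmult_plus_distr_r, Rmult_1_l, exp_plus, IH. simpl. ring.
Qed.

Lemma exp_inv_bound (k : nat) (x : R) : (0 < k)%nat -> 0 < x -> exp (- / x) <= (INR k * x) ^ k.
Proof.
  intros Hk Hx. assert (HK : 0 < INR k) by (apply lt_0_INR, Hk).
  assert (Hv : 0 < / (INR k * x)) by (apply Rinv_0_lt_compat, Rmult_lt_0_compat; assumption).
  replace (/ x) with (INR k * / (INR k * x)) by (field; lra).
  rewrite exp_Ropp, exp_INR_mult.
  rewrite <- (Rinv_inv (INR k * x)) at 2. rewrite pow_inv.
  apply Rinv_le_contravar; [apply pow_lt, Hv|].
  apply pow_incr. split; [lra|]. assert (H := exp_ineq1_le (/ (INR k * x))). lra.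
Qed.

(** The quadratic bound makes the function derivable at 0, with derivative 0. *)
Lemma flat_bound (n : nat) : exists K, 0 <= K /\ forall x, Rabs (flat n x) <= K * (x * x).
Proof.
  exists (INR (S (S n)) ^ S (S n)). split; [apply pow_le, pos_INR|].
  intros x. destruct (Rlt_dec 0 x) as [Hx|Hx].
  - rewrite flat_pos by exact Hx. assert (Hxn : 0 < x ^ n) by (apply pow_lt, Hx).
    rewrite Rabs_pos_eq.
    2:{ left. apply Rdiv_lt_0_compat; [apply exp_pos | exact Hxn]. }
    apply Rle_div_l; [exact Hxn|].
    eapply Rle_trans; [apply (exp_inv_bound (S (S n))); [lia | exact Hx]|].
    rewrite Rpow_mult_distr. right. rewrite <- (tech_pow_Rmult x), <- (tech_pow_Rmult x). ring.
  - rewrite flat_neg, Rabs_R0 by lra. apply Rmult_le_pos; [apply pow_le, pos_INR | nra].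
Qed.

Lemma is_derive_flat (n : nat) (x : R) :
  is_derive (flat n) x (- INR n * flat (S n) x + flat (S (S n)) x).
Proof.
  destruct (total_order_T 0 x) as [[Hx|Hx]|Hx].
  - apply is_derive_ext_loc with (fun y => exp (- / y) / y ^ n).
    { generalize (open_gt 0 x Hx). apply filter_imp. intros y Hy. symmetry. apply flat_pos, Hy. }
    rewrite !flat_pos by exact Hx.
    assert (Hxn : 0 < x ^ n) by (apply pow_lt, Hx).
    evar_last.
    { apply (is_derive_mult (K := R_AbsRing) (fun y => exp (- / y)) (fun y => / y ^ n)); [| | exact Rmult_comm].
      - auto_derive; [lra | reflexivity].
      - apply is_derive_inv; [|lra]. apply (is_derive_pow (fun y => y) n x 1). apply (is_derive_id (K := R_AbsRing)). }
    unfold plus, mult; simpl. destruct n as [|n]; simpl.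
    + field. lra.
    + assert (Hxm : 0 < x ^ n) by (apply pow_lt, Hx). field. lra.
  - subst x. rewrite !flat_neg by lra.
    destruct (flat_bound n) as [K [HK Hb]].
    apply is_derive_Reals. intros eps Heps.
    assert (Hd : 0 < eps / (K + 1)) by (apply Rdiv_lt_0_compat; lra).
    exists (mkposreal _ Hd). intros h Hh0 Hh. simpl in Hh.
    rewrite Rplus_0_l, (flat_neg n 0) by lra.
    replace ((flat n h - 0) / h - (- INR n * 0 + 0)) with (flat n h / h) by (field; exact Hh0).
    assert (Hp : 0 < Rabs h) by (apply Rabs_pos_lt, Hh0).
    unfold Rdiv. rewrite Rabs_mult, Rabs_inv. apply Rlt_div_l; [exact Hp|].
    apply Rlt_div_r in Hh; [|lra].
    assert (E := Rsqr_abs h). unfold Rsqr in E.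
    specialize (Hb h). rewrite E in Hb. nra.
  - apply is_derive_ext_loc with (fun _ => 0).
    { generalize (open_lt 0 x Hx). apply filter_imp. intros y Hy. symmetry. apply flat_neg. lra. }
    rewrite !flat_neg by lra. evar_last; [apply (is_derive_const (V := R_NormedModule))|].
    unfold zero; simpl. ring.
Qed.

Definition bump (x0 q0 : R) (n : nat) (m : R * R) : C :=
  RtoC (flat n (1 - (fst m - x0) * (fst m - x0) - (snd m - q0) * (snd m - q0))).

Lemma smooth_bump (x0 q0 : R) (n : nat) : smoothC (bump x0 q0 n).
Proof.
  apply (smooth_affine_span (fun f => exists n, f = bump x0 q0 n)).
  - intros f [k ->] m. apply continuous_C. split.
    + assert (Hk := cont_derive (flat k) _ (is_derive_flat k)).
      revert m. unfold bump, Re; simpl. cont.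
    + apply continuous_const.
  - intros f v [k ->].
    exists (fun m => affine (RtoC (2 * x0 * fst v + 2 * q0 * snd v)) (RtoC (- 2 * fst v)) (RtoC (- 2 * snd v)) m
      * (affine (RtoC (- INR k)) 0 0 m * bump x0 q0 (S k) m + bump x0 q0 (S (S k)) m))%C.
    split.
    + intros m. apply is_derive_C. split.
      * evar_last.
        { apply (is_derive_comp (flat k) (fun t =>
            1 - (fst m + t * fst v - x0) * (fst m + t * fst v - x0)
              - (snd m + t * snd v - q0) * (snd m + t * snd v - q0))).
          - apply is_derive_flat.
          - auto_derive; [exact I | reflexivity]. }
        unfold scal; simpl; unfold mult; simpl. rewrite !Rmult_0_l, !Rplus_0_r.
        unfold affine, bump, Re; simpl. ring.
      * evar_last. { exact (is_derive_const (K := R_AbsRing) (V := R_NormedModule) 0 0). }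
        unfold affine, bump, Im, zero; simpl. ring.
    + apply span_mult, span_plus; [apply span_mult|]; apply span_base; eexists; reflexivity.
  - apply span_base. exists n. reflexivity.
Qed.

Lemma Cc_smooth_bump (x0 q0 : R) : Cc_smooth (bump x0 q0 0).
Proof.
  split; [apply smooth_bump|]. exists (Rabs x0 + Rabs q0 + 1). intros x q H.
  unfold bump; simpl fst; simpl snd. f_equal. apply flat_neg.
  assert (Hx0 := Rabs_pos x0). assert (Hq0 := Rabs_pos q0).
  assert (Hsq : forall u, 1 <= Rabs u -> 1 <= u * u).
  { intros u Hu. assert (E := Rsqr_abs u). unfold Rsqr in E. rewrite E. nra. }
  destruct H as [H|H].
  - assert (H1 : 1 <= Rabs (x - x0)). { assert (H2 := Rabs_triang_inv x x0). lra. }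
    apply Hsq in H1. assert (H2 := Rle_0_sqr (q - q0)). unfold Rsqr in H2. lra.
  - assert (H1 : 1 <= Rabs (q - q0)). { assert (H2 := Rabs_triang_inv q q0). lra. }
    apply Hsq in H1. assert (H2 := Rle_0_sqr (x - x0)). unfold Rsqr in H2. lra.
Qed.

Lemma bump_center (x0 q0 : R) :
  bump x0 q0 0 (x0, q0) = RtoC (exp (- 1)) /\
  D1 (bump x0 q0 0) (x0, q0) = RtoC 0 /\ D2 (bump x0 q0 0) (x0, q0) = RtoC 0.
Proof.
  split; [|split].
  - unfold bump; simpl. f_equal.
    replace (1 - (x0 - x0) * (x0 - x0) - (q0 - q0) * (q0 - q0)) with 1 by ring.
    rewrite flat_pos by lra. simpl. unfold Rdiv. rewrite Rinv_1, Rmult_1_r. reflexivity.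
  - apply injective_projections; apply is_derive_unique.
    + unfold bump, Re; simpl. evar_last.
      { apply (is_derive_comp (flat 0) (fun a => 1 - (a - x0) * (a - x0) - (q0 - q0) * (q0 - q0))).
        - apply is_derive_flat.
        - auto_derive; [exact I | reflexivity]. }
      unfold scal; simpl; unfold mult; simpl. ring.
    + exact (is_derive_const (K := R_AbsRing) (V := R_NormedModule) 0 _).
  - apply injective_projections; apply is_derive_unique.
    + unfold bump, Re; simpl. evar_last.
      { apply (is_derive_comp (flat 0) (fun a => 1 - (x0 - x0) * (x0 - x0) - (a - q0) * (a - q0))).
        - apply is_derive_flat.
        - auto_derive; [exact I | reflexivity]. }
      unfold scal; simpl; unfold mult; simpl. ring.
    + exact (is_derive_const (K := R_AbsRing) (V := R_NormedModule) 0 _).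
Qed.

Lemma Cc_smooth_compact_in_x (f : R * R -> C) : Cc_smooth f -> exists M, compact_in_x M f.
Proof.
  intros [Hf [M HM]]. exists M. split; [exact Hf|]. intros x q H. apply HM. left. exact H.
Qed.

(** For a function with vanishing first derivatives at the point considered, the
    imaginary part of the Moyal series is the Taylor series of [B] and the real
    part is that of [Derive A], up to constants; the abscissa [- 2 y] makes the
    increment equal to [y]. *)
Lemma convergence_of_ell_hat_defined (A B : R -> R) (c y : R) :
  infinitely_derivable A -> infinitely_derivable B -> ell_hat_defined (symbol A B) ->
  ex_series (fun k => Derive_n B k c / INR (fact k) * y ^ k) /\
  ex_series (fun k => Derive_n (Derive A) k c / INR (fact k) * y ^ k).
Proof.
  intros HA HB Hdef.
  assert (Hb := Cc_smooth_bump (- 2 * y) c).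
  destruct (Cc_smooth_compact_in_x _ Hb) as [M HM].
  destruct (Hdef _ Hb (- 2 * y, c)) as [l Hl].
  destruct (bump_center (- 2 * y) c) as [E0 [E1 E2]].
  assert (He := exp_pos (- 1)).
  assert (Hterm := fun r => ell_hat_term_symbol M A B (bump (- 2 * y) c 0) (- 2 * y) c y r HA HB HM
    ltac:(field)).
  rewrite E0, E1, E2 in Hterm.
  split.
  - apply is_series_Im in Hl.
    assert (H := is_series_scal (V := R_NormedModule) (/ exp (- 1)) _ _ Hl).
    eexists. eapply is_series_ext; [|exact H]. intros r. cbv beta. rewrite Hterm.
    unfold scal; simpl; unfold mult; simpl. unfold Im; simpl. in_R. field. split; [|lra]. apply INR_fact_neq_0.
  - apply is_series_Re in Hl.
    assert (H := is_series_scal (V := R_NormedModule) (2 / exp (- 1)) _ _ Hl).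
    assert (Hex : ex_series (fun r => INR r / INR (fact r) * Derive_n A r c * y ^ pred r)).
    { eexists. eapply is_series_ext; [|exact H]. intros r. cbv beta. rewrite Hterm.
      unfold scal; simpl; unfold mult; simpl. unfold Re; simpl. in_R. field. split; [|lra]. apply INR_fact_neq_0. }
    apply ex_series_incr_1 in Hex. eapply ex_series_ext; [|exact Hex].
    intros n. cbv beta. rewrite derivative_weight, Derive_n_Derive. simpl pred. in_R. unfold Rdiv. ring.
Qed.

(** * The operator in both coordinate systems *)

Lemma D1_comp_xq_of_st (f : R * R -> C) (s t : R) : smoothC f ->
  D1 (fun m => f (xq_of_st m)) (s, t)
  = (RtoC (/ 2) * D2 f (xq_of_st (s, t)) - D1 f (xq_of_st (s, t)))%C.
Proof.
  intros Hf.
  destruct (smooth_D1 f Hf) as [Hs1 H1]. destruct (smooth_D2 f Hf) as [_ H2].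
  destruct (smooth_continuous _ Hs1) as [C1 C2].
  assert (Hchain : forall (u u1 u2 : R -> R -> R),
    (forall x q, is_derive (fun x => u x q) x (u1 x q)) ->
    (forall x q, is_derive (fun q => u x q) q (u2 x q)) ->
    (forall m : R * R, continuous (fun m => u1 (fst m) (snd m)) m) ->
    is_derive (fun a => u (t - a) ((a + t) / 2)) s
      (/ 2 * u2 (t - s) ((s + t) / 2) - u1 (t - s) ((s + t) / 2))).
  { intros u u1 u2 Hu1 Hu2 Hc.
    assert (Hd : differentiable_pt_lim u (t - s) ((s + t) / 2)
      (u1 (t - s) ((s + t) / 2)) (u2 (t - s) ((s + t) / 2))).
    { apply filterdiff_differentiable_pt_lim.
      apply (is_derive_filterdiff u _ _ u1 _); [apply filter_forall; intros m; apply Hu1 | apply Hu2 | apply Hc]. }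
    evar_last.
    - apply is_derive_Reals.
      apply (derivable_pt_lim_comp_2d u (fun a => t - a) (fun a => (a + t) / 2) s _ _ (-1) (/ 2) Hd);
        apply is_derive_Reals; auto_derive; try exact I; field.
    - ring. }
  apply injective_projections; apply is_derive_unique.
  - evar_last.
    + apply (Hchain (fun x q => Re (f (x, q))) (fun x q => Re (D1 f (x, q))) (fun x q => Re (D2 f (x, q)))).
      * intros x q. exact (proj1 (H1 x q)).
      * intros x q. exact (proj1 (H2 x q)).
      * intros m. apply continuous_ext with (fun m => Re (D1 f m)); [intros [? ?]; reflexivity | apply C1].
    + unfold xq_of_st, Re; simpl. ring.
  - evar_last.
    + apply (Hchain (fun x q => Im (f (x, q))) (fun x q => Im (D1 f (x, q))) (fun x q => Im (D2 f (x, q)))).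
      * intros x q. exact (proj2 (H1 x q)).
      * intros x q. exact (proj2 (H2 x q)).
      * intros m. apply continuous_ext with (fun m => Im (D1 f m)); [intros [? ?]; reflexivity | apply C2].
    + unfold xq_of_st, Im; simpl. ring.
Qed.

Theorem theorem3p2p5
  (G : MD4) (F : R4) (psi : R * R -> R4) (A : R4) (Phi Psi : R -> R)
  (hG : admissible G)
  (hF : nontrivial_orbit G F)
  (hpsi : adapted_chart G F psi)
  (hA : forall p q : R, pairing (psi (p, q)) A = Phi q * p + Psi q) :
  (entire Phi -> entire Psi -> ell_hat_defined (tilde psi A))
  /\
  (ell_hat_defined (tilde psi A) ->
   forall f : R * R -> C, Cc_smooth f ->
     (forall x q : R,
        ell_hat (tilde psi A) f (x, q)
        = (Phi (q - x / 2)%R * (/ 2 * D2 f (x, q) - D1 f (x, q))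
           + Ci * Psi (q - x / 2)%R * f (x, q)
           + (/ 2 * Derive Phi (q - x / 2))%R * f (x, q))%C)
     /\
     (forall s t : R,
        let f_st := fun m : R * R => f (xq_of_st m) in
        ell_hat (tilde psi A) f (xq_of_st (s, t))
        = (Phi s * D1 f_st (s, t)
           + Ci * Psi s * f_st (s, t)
           + (/ 2 * Derive Phi s)%R * f_st (s, t))%C)).
Proof.
  assert (E : tilde psi A = symbol Phi Psi).
  { apply functional_extensionality. intros [p q]. unfold tilde, symbol; simpl. rewrite hA. reflexivity. }
  rewrite E.
  assert (Hsm : infinitely_derivable Phi /\ infinitely_derivable Psi).
  { destruct hpsi as [_ [Haff _]]. destruct (Haff A) as [Phi' [Psi' [S1 [S2 H]]]].
    assert (EPsi : Psi' = Psi).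
    { apply functional_extensionality. intros q. specialize (H 0 q). rewrite hA in H. lra. }
    assert (EPhi : Phi' = Phi).
    { apply functional_extensionality. intros q. specialize (H 1 q). rewrite hA, EPsi in H. lra. }
    subst. split; apply smooth_infinitely_derivable; assumption. }
  destruct Hsm as [HPhi HPsi].
  split.
  - intros hPhi hPsi f Hf [x q].
    destruct (Cc_smooth_compact_in_x f Hf) as [M HM].
    assert (Hex : forall g, entire g ->
      forall c y, ex_series (fun k => Derive_n g k c / INR (fact k) * y ^ k)).
    { intros g Hg c y. eexists. eapply is_series_ext; [|exact (Hg c (c + y))].
      intros n. cbv beta. replace (c + y - c) with y by ring. reflexivity. }
    eexists. apply (is_series_ell_hat M); try assumption; apply pringsheim_of_convergence; auto.
  - intros Hdef f Hf.
    destruct (Cc_smooth_compact_in_x f Hf) as [M HM].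
    assert (EPhi : forall c z, expands Phi c z).
    { apply pringsheim_of_Derive_convergence; [exact HPhi|].
      intros c y. apply (convergence_of_ell_hat_defined Phi Psi c y HPhi HPsi Hdef). }
    assert (EPsi : forall c z, expands Psi c z).
    { apply pringsheim_of_convergence; [exact HPsi|].
      intros c y. apply (convergence_of_ell_hat_defined Phi Psi c y HPhi HPsi Hdef). }
    assert (Hxq : forall x q : R,
        ell_hat (symbol Phi Psi) f (x, q)
        = (Phi (q - x / 2)%R * (/ 2 * D2 f (x, q) - D1 f (x, q))
           + Ci * Psi (q - x / 2)%R * f (x, q)
           + (/ 2 * Derive Phi (q - x / 2))%R * f (x, q))%C).
    { intros x q. unfold ell_hat.
      rewrite (CSeries_unique _ _ (is_series_ell_hat M Phi Psi f x q HPhi HPsi EPhi EPsi HM)).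
      rewrite <- RtoC_inv by lra. reflexivity. }
    split; [exact Hxq|].
    intros s t f_st. unfold f_st. rewrite (D1_comp_xq_of_st f s t (proj1 Hf)).
    change (xq_of_st (s, t)) with (t - s, (s + t) / 2). rewrite Hxq.
    replace ((s + t) / 2 - (t - s) / 2) with s by field.
    rewrite <- RtoC_inv by lra. reflexivity.
Qed.
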